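(* Let $F_1,F_2,F_3$ be three forests of nonplanar rooted binary trees. Then $$\langle F_1\ast F_2,\,F_3\rangle=\langle F_2\otimes F_1,\,\Delta(F_3)\rangle .$$ Consequently $\Delta=\Delta_\ast$, where $\Delta_\ast$ is the coproduct on $k[\mathcal{T}]$ defined by requiring $\langle F_1\ast F_2,F_3\rangle=\langle F_2\otimes F_1,\Delta_\ast(F_3)\rangle$ for all forests $F_1,F_2,F_3$.
   Context: Trees and forests. A (nonplanar rooted) binary tree is a finite rooted tree, without a planar embedding, in which every vertex has either $0$ or $2$ children; vertices with $0$ children are the leaves (the single-vertex tree is allowed). Leaves may carry labels from a fixed set, and isomorphisms preserve roots and labels. Edges are directed away from the root, and the parent vertex of an edge is its upper endpoint. $E(T)$ is the edge set of $T$. Let $k$ be a field of characteristic $0$, $\mathcal{T}$ the set of isomorphism classes of binary trees, $k\{\mathcal{T}\}$ the vector space with basis $\mathcal{T}$, and $k[\mathcal{T}]=\mathrm{Sym}(k\{\mathcal{T}\})$ the polynomial algebra, which has as basis the forests (multisets of binary trees), with product the disjoint union and empty forest $1$. The coproduct $\Delta$. A binary-admissible cut of $T$ is a subset $C\subseteq E(T)$ such that (1) no two edges of $C$ lie on the same path from the root to a leaf, and (2) no two edges of $C$ share the same parent vertex (the empty set is allowed). For such $C$, delete the edges of $C$ from $T$: $P^C(T)$ is the forest of the subtrees lying below the edges of $C$, and $R^C(T)$ is the full binary tree obtained from the component containing the root of $T$ by suppressing all vertices having exactly one child (including the root, if it has exactly one child), leaf labels being kept. Put $$\Delta(T)=T\otimes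 1+\sum_{C\ \text{binary-admissible cut of }T}P^C(T)\otimes R^C(T)$$ and extend $\Delta$ to $k[\mathcal{T}]$ as an algebra morphism. The product $\ast$. For trees $T,S$ and $e\in E(T)$, $T\triangleleft_e S$ is the tree obtained by splitting $e$ by a new vertex and joining the root of $S$ to it by a new edge. Let $\mathfrak{M}(T,S)$ be the tree whose root has the two child subtrees $T$ and $S$. Set $T\triangleleft S=\mathfrak{M}(T,S)+\sum_{e\in E(T)}T\triangleleft_e S$, extended bilinearly; this is a right pre-Lie product on $\mathcal{L}=k\{\mathcal{T}\}$. Let $\mathrm{Sh}$ be the unshuffle coproduct on $\mathrm{Sym}(\mathcal{L})$, $\mathrm{Sh}(x_1\cdots x_n)=\sum_{I\subseteq\{1,\dots,n\}}x_I\otimes x_{\{1,\dots,n\}\setminus I}$ for $x_i\in\mathcal{L}$, where $x_J=\prod_{j\in J}x_j$; write $\mathrm{Sh}(B)=\sum_{(B)}B_{(1)}\otimes B_{(2)}$. The product $\triangleleft$ extends uniquely to a bilinear operation on $\mathrm{Sym}(\mathcal{L})=k[\mathcal{T}]$ (Guin–Oudom construction) such that, for $X,Y\in\mathcal{L}$ and $A,B,C\in\mathrm{Sym}(\mathcal{L})$: (i) $A\triangleleft 1=A$; (ii) $X\triangleleft(AY)=(X\triangleleft A)\triangleleft Y-X\triangleleft(A\triangleleft Y)$; (iii) $(AB)\triangleleft C=\sum_{(C)}(A\triangleleft C_{(1)})(B\triangleleft C_{(2)})$. Then $$A\ast B=\sum_{(B)}(A\triangleleft B_{(1)})\,B_{(2)},$$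 and $(\mathrm{Sym}(\mathcal{L}),\ast,\mathrm{Sh})$ is a Hopf algebra isomorphic to the universal enveloping algebra of the Lie algebra $\mathcal{L}$ with bracket $[x,y]=x\triangleleft y-y\triangleleft x$. The pairing. For a forest $F$, $s_F$ is the number of automorphisms of $F$ (graph automorphisms preserving roots and leaf labels). The pairing on $k[\mathcal{T}]$ is the bilinear form with $\langle F,F'\rangle=s_F\,\delta_{F,F'}$ for forests $F,F'$, and on tensor squares $\langle A\otimes B,C\otimes D\rangle=\langle A,C\rangle\langle B,D\rangle$. *)

(* Defs.v *)
From HB Require Import structures.
From mathcomp Require Import all_boot all_order all_algebra finmap generic_quotient.
From mathcomp.multinomials Require Export monalg.

Set Implicit Arguments.
Unset Strict Implicit.
Unset Printing Implicit Defensive.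

Import GRing.Theory.

Local Open Scope ring_scope.
Local Open Scope quotient_scope.

(* Planar binary trees; nonplanar trees are their isomorphism classes. *)
Inductive ptree (A : Type) : Type :=
| PLeaf of A
| PNode of ptree A & ptree A.

Section PTreeChoice.
Variable A : choiceType.

Fixpoint ptree_encode (t : ptree A) : GenTree.tree A :=
  match t with
  | PLeaf a => GenTree.Leaf a
  | PNode l r => GenTree.Node 0 [:: ptree_encode l; ptree_encode r]
  end.

Fixpoint ptree_decode (t : GenTree.tree A) : option (ptree A) :=
  match t with
  | GenTree.Leaf a => Some (PLeaf a)
  | GenTree.Node _ [:: l; r] =>
      if (ptree_decode l, ptree_decode r) is (Some l', Some r')
      then Some (PNode l' r') else None
  | _ => None
  end.

Lemma ptree_encodeK : pcancel ptree_encode ptree_decode.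
Proof. by elim=> //= l -> r ->. Qed.

HB.instance Definition _ := Choice.copy (ptree A) (pcan_type ptree_encodeK).

End PTreeChoice.

Section PlanarTrees.
Variable A : choiceType.
Implicit Types t : ptree A.

(* In [vertex (PNode l r)], [None] is the root. *)
Fixpoint vertex t : finType :=
  match t with
  | PLeaf _ => unit
  | PNode l r => option (vertex l + vertex r)
  end.

Definition troot t : vertex t :=
  match t with
  | PLeaf _ => tt
  | PNode _ _ => None
  end.

Fixpoint parent t : vertex t -> option (vertex t) :=
  match t with
  | PLeaf _ => fun=> None
  | PNode l r => fun v =>
      match v with
      | None => None
      | Some (inl u) => Some (omap inl (parent u))
      | Some (inr u) => Some (omap inr (parent u))
      end
  end.

(* [None] exactly on the vertices that are not leaves *)
Fixpoint label t : vertex t -> option A :=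
  match t with
  | PLeaf a => fun=> Some a
  | PNode l r => fun v =>
      match v with
      | None => None
      | Some (inl u) => label u
      | Some (inr u) => label u
      end
  end.

(* Each edge is represented by its lower endpoint. *)
Definition edges t : {set vertex t} := [set~ troot t].

Definition below t (v w : vertex t) : bool :=
  connect (fun u u' => parent u' == Some u) v w.

Fixpoint subtree t : vertex t -> ptree A :=
  match t with
  | PLeaf a => fun=> PLeaf a
  | PNode l r => fun v =>
      match v with
      | None => PNode l r
      | Some (inl u) => subtree u
      | Some (inr u) => subtree u
      end
  end.

(* For an edge [v], this splits [v] and hangs [s] at the new vertex. *)
Fixpoint graft (s : ptree A) t : vertex t -> ptree A :=
  match t with
  | PLeaf a => fun=> PNode (PLeaf a) s
  | PNode l r => fun v =>
      match v with
      | None => PNode (PNode l r) s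
      | Some (inl u) => PNode (graft s u) r
      | Some (inr u) => PNode l (graft s u)
      end
  end.

Definition admissible t (C : {set vertex t}) : bool :=
  [&& C \subset edges t,
      [forall w, forall e in C, forall f in C,
        [&& label w != None, below e w & below f w] ==> (e == f)]
    & [forall e in C, forall f in C, (parent e == parent f) ==> (e == f)]].

(* The component of the root once the edges in [C] are deleted, with the
   vertices left with one child suppressed.  An admissible [C] never contains
   both edges below a vertex. *)
Fixpoint remainder t : pred (vertex t) -> ptree A :=
  match t with
  | PLeaf a => fun=> PLeaf a
  | PNode l r => fun C =>
      let Cl u := C (Some (inl u)) in
      let Cr u := C (Some (inr u)) in
      if Cl (troot l) then remainder Cr
      else if Cr (troot r) then remainder Cl
      else PNode (remainder Cl) (remainder Cr)
  end.

End PlanarTrees.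

Section Isomorphisms.
Variable A : choiceType.

(* Isomorphisms between finite rooted forests given by their parent and leaf
   label functions; roots are the vertices without a parent. *)
Definition isos (V W : finType) (pV : V -> option V) (pW : W -> option W)
    (lV : V -> option A) (lW : W -> option A) : {set {ffun V -> W}} :=
  [set f : {ffun V -> W} | [&& injectiveb f, [forall w, w \in codom f],
               [forall v, pW (f v) == omap f (pV v)]
             & [forall v, lW (f v) == lV v]]].

Lemma isosP (V W : finType) (pV : V -> option V) (pW : W -> option W)
    (lV : V -> option A) (lW : W -> option A) (f : {ffun V -> W}) :
  reflect [/\ bijective f, forall v, pW (f v) = omap f (pV v)
            & forall v, lW (f v) = lV v]
          (f \in isos pV pW lV lW).
Proof.
rewrite inE; apply: (iffP and4P).
  move=> [/injectiveP inj /forallP surj /forallP hp /forallP hl].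
  split=> [|v|v]; try exact/eqP.
  by exists (fun w => iinv (surj w)) => [v|w]; [apply: inj|]; rewrite f_iinv.
move=> [bij hp hl]; split; try by apply/forallP=> v; apply/eqP.
  exact/injectiveP/bij_inj.
by case: bij => g _ gK; apply/forallP=> w; rewrite -[w]gK codom_f.
Qed.

Definition ptree_isos (t u : ptree A) : {set {ffun vertex t -> vertex u}} :=
  isos (@parent A t) (@parent A u) (@label A t) (@label A u).

Definition ptree_iso (t u : ptree A) : bool := ptree_isos t u != set0.

Lemma ptree_isoP t u :
  reflect (exists f : vertex t -> vertex u,
             [/\ bijective f, forall v, parent (f v) = omap f (parent v)
               & forall v, label (f v) = label v])
          (ptree_iso t u).
Proof.
apply: (iffP (set0Pn _)) => [[f /isosP hf]|[f [bij hp hl]]].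
  by exists f.
exists (finfun f); apply/isosP; split=> [|v|v]; last by rewrite ffunE.
  by apply: (eq_bij bij) => v; rewrite ffunE.
by rewrite ffunE hp; apply: eq_omap => w; rewrite ffunE.
Qed.

Lemma ptree_iso_refl : reflexive ptree_iso.
Proof.
move=> t; apply/ptree_isoP; exists id; split=> // [|v]; first by exists id.
by rewrite omap_id.
Qed.

Lemma ptree_iso_trans : transitive ptree_iso.
Proof.
move=> u t w /ptree_isoP[f [bf pf lf]] /ptree_isoP[g [bg pg lg]].
apply/ptree_isoP; exists (g \o f); split=> [|v|v] /=.
- exact: bij_comp.
- by rewrite pg pf; case: (parent v).
- by rewrite lg lf.
Qed.

Lemma ptree_iso_sym : symmetric ptree_iso.
Proof.
suff sub t u : ptree_iso t u -> ptree_iso u t by move=> t u; apply/idP/idP; apply: sub.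
move=> /ptree_isoP[f [[g fK gK] pf lf]].
apply/ptree_isoP; exists g; split=> [|w|w]; first by exists f.
  have := pf (g w); rewrite gK => ->.
  by case: (parent (g w)) => //= v; rewrite fK.
by rewrite -lf gK.
Qed.

End Isomorphisms.

Section Trees.
Variable A : choiceType.

Definition ptree_iso_equiv : equiv_rel (ptree A) :=
  EquivRel (@ptree_iso A) (@ptree_iso_refl A) (@ptree_iso_sym A)
    (@ptree_iso_trans A).

Definition tree : Type := {eq_quot ptree_iso_equiv}.

HB.instance Definition _ := Choice.on tree.
HB.instance Definition _ := EqQuotient.on tree.

End Trees.

(* The elements of a multiset, repeated according to multiplicity. *)
Definition mon_seq (I : choiceType) (m : {cmonom I}) : seq I :=
  flatten [seq nseq (m i) i | i <- finsupp m].

(* Forests are multisets of trees, i.e. commutative monomials in trees. *)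
Notation forest A := {cmonom tree A}.

Section Forests.
Variable A : choiceType.
Implicit Types F : forest A.

Fixpoint fvertex (s : seq (ptree A)) : finType :=
  match s with
  | [::] => void
  | t :: s' => (vertex t + fvertex s')%type
  end.

Fixpoint fparent (s : seq (ptree A)) : fvertex s -> option (fvertex s) :=
  match s with
  | [::] => fun=> None
  | t :: s' => fun v =>
      match v with
      | inl u => omap inl (parent u)
      | inr u => omap inr (fparent u)
      end
  end.

Fixpoint flabel (s : seq (ptree A)) : fvertex s -> option A :=
  match s with
  | [::] => fun=> None
  | t :: s' => fun v =>
      match v with
      | inl u => label u
      | inr u => flabel u
      end
  end.

Definition num_aut F : nat :=
  let s := [seq repr T | T <- mon_seq F] in
  #|isos (@fparent s) (@fparent s) (@flabel s) (@flabel s)|.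

End Forests.

Section ProdMonom.
Variables M N : conomType.

Definition prod_one : M * N := (mone, mone).
Definition prod_mul (p q : M * N) : M * N := (mmul p.1 q.1, mmul p.2 q.2).

Lemma prod_mulA : associative prod_mul.
Proof. by move=> p q r; rewrite /prod_mul !mulmA. Qed.

Lemma prod_mul1 : left_id prod_one prod_mul.
Proof. by case=> p q; rewrite /prod_mul !mul1m. Qed.

Lemma prod_mulr1 : right_id prod_one prod_mul.
Proof. by case=> p q; rewrite /prod_mul !mulm1. Qed.

Lemma prod_unitm p q : prod_mul p q = prod_one -> p = prod_one /\ q = prod_one.
Proof. by case: p q => [p p'] [q q'] [/unitm[-> ->] /unitm[-> ->]]. Qed.

Lemma prod_mulC : commutative prod_mul.
Proof. by move=> p q; rewrite /prod_mul !(mulmC p.1, mulmC p.2). Qed.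

HB.instance Definition _ := Choice_isMonomialDef.Build (M * N)%type
  prod_mulA prod_mul1 prod_mulr1 prod_unitm.
HB.instance Definition _ := MonomialDef_isConomialDef.Build (M * N)%type
  prod_mulC.

End ProdMonom.

Section LinearExtension.
Variable k : fieldType.

Definition linext (K : choiceType) (V : lmodType k) (f : K -> V)
    (x : {malg k[K]}) : V :=
  \sum_(i <- msupp x) x@_i *: f i.

Definition bilext (K L : choiceType) (V : lmodType k) (f : K -> L -> V)
    (x : {malg k[K]}) (y : {malg k[L]}) : V :=
  linext (fun i => linext (f i) y) x.

End LinearExtension.

(* Sym(L) for the free module L with basis I, and Sym(L) (x) Sym(L). *)
Notation sym k I := {malg k[{cmonom I}]}.
Notation sym2 k I := {malg k[({cmonom I} * {cmonom I})%type]}.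

Section SymmetricAlgebra.
Variables (k : fieldType) (I : choiceType).
Local Notation L := {malg k[I]}.

Definition tens (x y : sym k I) : sym2 k I :=
  bilext (fun m n => << (m, n) >> : sym2 k I) x y.

Definition gen (i : I) : sym k I := << ucm i >>.

Definition incl (X : L) : sym k I := linext gen X.

Definition Sh (x : sym k I) : sym2 k I :=
  linext (fun m =>
    let t := tnth (in_tuple (mon_seq m)) in
    \sum_(J : {set 'I_(size (mon_seq m))})
       tens (\prod_(j in J) gen (t j)) (\prod_(j in ~: J) gen (t j))) x.

(* [tri] is the extension of the product [pl] of L to Sym(L). *)
Record guin_oudom (pl : L -> L -> L)
    (tri : {bilinear sym k I -> sym k I -> sym k I}) : Prop := GuinOudom {
  go_prelie : forall X Y : L, tri (incl X) (incl Y) = incl (pl X Y);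
  go_unit : forall a : sym k I, tri a 1 = a;
  go_mulr : forall (X Y : L) (a : sym k I),
    tri (incl X) (a * incl Y)
    = tri (tri (incl X) a) (incl Y) - tri (incl X) (tri a (incl Y));
  go_mull : forall a b c : sym k I,
    tri (a * b) c
    = linext (fun p : {cmonom I} * {cmonom I} =>
                tri a << p.1 >> * tri b << p.2 >>) (Sh c)
}.

Definition star (tri : sym k I -> sym k I -> sym k I) (a b : sym k I) :
    sym k I :=
  linext (fun p : {cmonom I} * {cmonom I} => tri a << p.1 >> * << p.2 >>)
    (Sh b).

End SymmetricAlgebra.

Section TreeOperations.
Variables (k : fieldType) (A : choiceType).

Definition tree_prelie (T S : tree A) : {malg k[tree A]} :=
  let t := repr T in
  let s := repr S in
  << \pi_(tree A) (PNode t s) >>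
  + \sum_(e in edges t) << \pi_(tree A) (graft s e) >>.

Definition prelie (X Y : {malg k[tree A]}) : {malg k[tree A]} :=
  bilext tree_prelie X Y.

Definition pgen (t : ptree A) : sym k (tree A) := gen k (\pi_(tree A) t).

Definition Delta_tree (T : tree A) : sym2 k (tree A) :=
  let t := repr T in
  tens (gen k T) 1
  + \sum_(C : {set vertex t} | admissible C)
      tens (\prod_(e in C) pgen (subtree e)) (pgen (remainder (mem C))).

Definition Delta (x : sym k (tree A)) : sym2 k (tree A) :=
  linext (fun F => \prod_(T <- mon_seq F) Delta_tree T) x.

Definition pairing (x y : sym k (tree A)) : k :=
  bilext (fun F G => (if F == G then (num_aut F)%:R else 0) : k^o) x y.

Definition pairing2 (x y : sym2 k (tree A)) : k :=
  bilext (fun p q : forest A * forest A =>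
            (pairing << p.1 >> << q.1 >> * pairing << p.2 >> << q.2 >>) : k^o)
         x y.

End TreeOperations.

(* Main.v *)
Require Import Defs.
From mathcomp Require Import all_boot all_order all_algebra.
From mathcomp Require Import finmap generic_quotient ring.

(* Let D_S be the adjoint, for the pairing, of right multiplication F |-> F * S
   by a tree S.  It is the derivation of k[T] sending a tree U to
   <S, U> plus the sum over the edges e of U of <S, P^e(U)> R^e(U).
   The Guin-Oudom axioms give A * (B * S) = (A * B) * S for S a tree, that is
   A * (B S) = (A * B) * S - A * (B <| S), where B <| S has as many factors as B.
   Hence the duality follows, by induction on the number of trees in F2, from
   Delta o D_S = (D_S (x) id) o Delta.  Both sides are derivations along Delta,
   so this is checked on trees, by recursion: an admissible cut of M(l, r)
   is either a pair of admissible cuts of l and r, or one of the two root edges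
   together with an admissible cut of the other subtree.
   In characteristic 0 the s_F are invertible, so the pairing is nondegenerate
   and determines the coproduct. *)

Set Implicit Arguments.
Unset Strict Implicit.
Unset Printing Implicit Defensive.

Import GRing.Theory.
Local Open Scope ring_scope.

(** The pairing is handled as a count: there are s_F isomorphisms from F to F' if the two forests
    are equal, and none otherwise. Unlike s_F, the number of isomorphisms between two forests obeys
    a recursion, by choosing the image of the first tree. Read through the pairing, this recursion
    says that multiplication by a tree T is adjoint to the derivation s_T d/dT. The adjointness of
    D_S is then obtained from (T x) * S = (T <| S) x + T (x * S): dually, the commutator of the
    derivations attached to T and S is again a derivation, and its values on trees come from
    counting isomorphisms from the grafts of S on T. The obstacle is that a tree is a class with an
    arbitrary planar representative, and cutting the representative leaves planar trees that need
    not be representatives. Cut sums are therefore put in a recursive form symmetric in the two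
    subtrees, from which their invariance under isomorphism is read off. They take an arbitrary
    function of P^C and R^C, so that an induction on one subtree can absorb the factors contributed
    by the other. *)

Section Picks.

(** The same pattern describes the choice of the image of the first tree under an isomorphism of
    forests and the Leibniz rule on a product of generators. *)
Fixpoint picks (T : Type) (s : seq T) : seq (T * seq T) :=
  if s is x :: s' then (x, s') :: [seq (p.1, x :: p.2) | p <- picks s'] else [::].

Lemma picks_map (T U : Type) (f : T -> U) s :
  picks (map f s) = [seq (f p.1, map f p.2) | p <- picks s].
Proof. by elim: s => //= x s ->; rewrite -!map_comp. Qed.

Variables (T : eqType) (V : nmodType).
Implicit Types s u : seq T.

Lemma perm_picks s p : p \in picks s -> perm_eq (p.1 :: p.2) s.
Proof.
elim: s p => [|x s IH] p //=; rewrite inE => /orP[/eqP -> //|/mapP[q /IH qs ->]] /=.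
rewrite -[q.1 :: _]cat1s -[x :: q.2]cat1s perm_catCA /= perm_cons; exact: qs.
Qed.

(** Passing to [rem] leaves a plain sum over [s], which [perm_big] can permute. When an entry occurs
    twice, [picks] and [rem] may remove different copies, hence the condition on [F]. *)
Lemma big_picks (F : T -> seq T -> V) s :
  (forall x u u', perm_eq u u' -> F x u = F x u') ->
  \sum_(p <- picks s) F p.1 p.2 = \sum_(x <- s) F x (rem x s).
Proof.
elim: s F => [|y s IH] F Fperm /=; first by rewrite !big_nil.
rewrite !big_cons eqxx big_map /= (IH (fun x u => F x (y :: u))) => [|x u u' uu'];
  last first.
  by apply: Fperm; rewrite perm_cons.
congr (_ + _); apply: eq_big_seq => x xs; case: eqP => [->|//].
by apply: Fperm; rewrite perm_sym perm_to_rem.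
Qed.

Lemma perm_big_picks (F : T -> seq T -> V) s s' :
  (forall x u u', perm_eq u u' -> F x u = F x u') -> perm_eq s s' ->
  \sum_(p <- picks s) F p.1 p.2 = \sum_(p <- picks s') F p.1 p.2.
Proof.
move=> Fperm ss'; rewrite !big_picks // (perm_big _ ss');
  apply: eq_big_seq => x xs'.
apply: Fperm; rewrite -(perm_cons x) -(permPl (perm_to_rem _)) ?(perm_mem ss') //.
by rewrite -(permPr (perm_to_rem xs')).
Qed.

End Picks.

(** * Counting isomorphisms of trees and forests *)

Section Isos.
Variable A : choiceType.

Definition is_iso (V W : finType) (pV : V -> option V) (pW : W -> option W)
    (lV : V -> option A) (lW : W -> option A) (f : V -> W) : Prop :=
  [/\ bijective f, forall v, pW (f v) = omap f (pV v)
    & forall v, lW (f v) = lV v].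

Section Generic.
Variables (V W X : finType) (pV : V -> option V) (pW : W -> option W).
Variables (pX : X -> option X).
Variables (lV : V -> option A) (lW : W -> option A) (lX : X -> option A).

Lemma is_iso_comp f g :
  is_iso pV pW lV lW f -> is_iso pW pX lW lX g -> is_iso pV pX lV lX (g \o f).
Proof.
move=> [bf pf lf] [bg pg lg]; split=> [|v|v] /=; first exact: bij_comp.
  by rewrite pg pf; case: (pV v).
by rewrite lg lf.
Qed.

Lemma is_iso_inv f : is_iso pV pW lV lW f ->
  exists g, [/\ is_iso pW pV lW lV g, cancel f g & cancel g f].
Proof.
move=> [[g fK gK] pf lf]; exists g; split=> //; split=> [|w|w]; first by exists f.
  by rewrite -{2}[w]gK pf; case: (pV (g w)) => //= v; rewrite fK.
by rewrite -lf gK.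
Qed.

Lemma is_iso_ffun f : is_iso pV pW lV lW f -> finfun f \in isos pV pW lV lW.
Proof.
move=> [bf pf lf]; apply/isosP; split=> [|v|v]; last by rewrite ffunE.
  by apply: (eq_bij bf) => v; rewrite ffunE.
by rewrite ffunE pf; apply: eq_omap => w; rewrite ffunE.
Qed.

End Generic.

(** Conjugation by [psi] and [phi] is injective; used for the inverses as well, it yields
    equalities. The predicates [P] and [Q] make room for isomorphisms with a prescribed value at one
    vertex. *)
Lemma leq_card_isos (V W V' W' : finType) (pV : V -> option V)
    (pW : W -> option W) (pV' : V' -> option V') (pW' : W' -> option W')
    (lV : V -> option A) (lW : W -> option A) (lV' : V' -> option A)
    (lW' : W' -> option A) (psi : V' -> V) (phi : W -> W') (P : pred {ffun V -> W})
    (Q : pred {ffun V' -> W'}) :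
  is_iso pV' pV lV' lV psi -> is_iso pW pW' lW lW' phi ->
  (forall f, P f -> Q [ffun v => phi (f (psi v))]) ->
  (#|[set f in isos pV pW lV lW | P f]|
     <= #|[set f in isos pV' pW' lV' lW' | Q f]|)%N.
Proof.
move=> ipsi iphi PQ; have [[psi' psiK psi'K] _ _] := ipsi.
have [[phi' phiK _] _ _] := iphi.
pose h (f : {ffun V -> W}) := [ffun v => phi (f (psi v))].
have h_inj : injective h.
  move=> f g /ffunP fg; apply/ffunP=> v; have := fg (psi' v).
  by rewrite !ffunE psi'K => /(can_inj phiK).
rewrite -(card_imset _ h_inj); apply/subset_leq_card/subsetP=> _ /imsetP[f + ->].
rewrite inE [in X in _ -> X]inE => /andP[/isosP fi Pf]; rewrite PQ // andbT.
exact: is_iso_ffun (is_iso_comp ipsi (is_iso_comp fi iphi)).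
Qed.

Lemma card_isos_eq (V W V' W' : finType) (pV : V -> option V)
    (pW : W -> option W) (pV' : V' -> option V') (pW' : W' -> option W')
    (lV : V -> option A) (lW : W -> option A) (lV' : V' -> option A)
    (lW' : W' -> option A) (psi : V' -> V) (phi : W -> W') :
  is_iso pV' pV lV' lV psi -> is_iso pW pW' lW lW' phi ->
  #|isos pV pW lV lW| = #|isos pV' pW' lV' lW'|.
Proof.
move=> ipsi iphi; have [psi' [ipsi' _ _]] := is_iso_inv ipsi.
have [phi' [iphi' _ _]] := is_iso_inv iphi.
have E (V0 W0 : finType) (S : {set {ffun V0 -> W0}}) :
  S = [set f in S | xpredT f] by apply/setP=> f; rewrite !inE andbT.
apply/eqP; rewrite eqn_leq (E _ _ (isos pV _ _ _)) (E _ _ (isos pV' _ _ _)).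
by rewrite (leq_card_isos ipsi iphi) //= (leq_card_isos ipsi' iphi').
Qed.

Lemma card_pinned_eq (V W W' : finType) (pV : V -> option V)
    (pW : W -> option W) (pW' : W' -> option W')
    (lV : V -> option A) (lW : W -> option A)
    (lW' : W' -> option A) (phi : W -> W') v w :
  is_iso pW pW' lW lW' phi ->
  #|[set f in isos pV pW lV lW | f v == w]|
   = #|[set f in isos pV pW' lV lW' | f v == phi w]|.
Proof.
move=> iphi; have iV : is_iso pV pV lV lV id.
  by split=> // [|x]; [exists id | rewrite omap_id].
have [phi' [iphi' phiK phi'K]] := is_iso_inv iphi.
apply/eqP; rewrite eqn_leq (leq_card_isos iV iphi) => [|f /eqP <-]; last first.
  by rewrite ffunE.
by rewrite (leq_card_isos iV iphi') // => f /eqP fv; rewrite ffunE fv phiK.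
Qed.

End Isos.

Section Trees.
Variable A : choiceType.
Implicit Types (t x y : ptree A) (s u w : seq (ptree A)).

Definition tcount t x : nat := #|ptree_isos t x|.

Definition fcount s u : nat :=
  #|isos (@fparent A s) (@fparent A u) (@flabel A s) (@flabel A u)|.

Lemma parent_None t (v : vertex t) : (parent v == None) = (v == troot t).
Proof. by case: t v => [a []|l r [[v|v]|]]. Qed.

Lemma parent_troot t : parent (troot t) = None.
Proof. by case: t. Qed.

Lemma vertex_ind t (P : vertex t -> Prop) : P (troot t) ->
  (forall v v', parent v = Some v' -> P v' -> P v) -> forall v, P v.
Proof.
elim: t P => [a|l IHl r IHr] P /= P0 PS; first by case.
case=> [[v|v]|//].
  apply: (IHl (fun v => P (Some (inl v)))) => [|u w pu].
    by apply: (PS _ None) => //=; rewrite parent_troot.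
  by apply: PS; rewrite /= pu.
apply: (IHr (fun v => P (Some (inr v)))) => [|u w pu].
  by apply: (PS _ None) => //=; rewrite parent_troot.
by apply: PS; rewrite /= pu.
Qed.

Fixpoint pick_at u : fvertex u -> ptree A * seq (ptree A) :=
  match u return fvertex u -> ptree A * seq (ptree A) with
  | [::] => fun v => match v with end
  | y :: u' => fun v =>
      match v with
      | inl _ => (y, u')
      | inr v' => ((pick_at v').1, y :: (pick_at v').2)
      end
  end.

Lemma big_pick_at (R : Type) (idx : R) (op : Monoid.com_law idx) u
    (F : ptree A * seq (ptree A) -> R) :
  \big[op/idx]_(v : fvertex u | fparent v == None) F (pick_at v)
  = \big[op/idx]_(p <- picks u) F p.
Proof.
elim: u F => [|y u IHu] F /=.
  by rewrite big_nil big1 // => -[].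
rewrite big_sumType /= big_cons big_map -IHu; congr (op _ _).
  rewrite (big_pred1 (troot y)) // => v /=.
  by rewrite -parent_None; case: (parent v).
by apply: eq_bigl => v; case: (fparent v).
Qed.

(** A root [v] singles out its tree; [phi] moves that tree to the front, which reduces the count of
    isomorphisms with value [v] to [card_pinned_cons]. *)
Lemma pick_at_iso u (v : fvertex u) : fparent v = None ->
  exists phi : fvertex u -> fvertex ((pick_at v).1 :: (pick_at v).2),
    is_iso (@fparent A u) (@fparent A _) (@flabel A u) (@flabel A _) phi
    /\ phi v = inl (troot (pick_at v).1).
Proof.
elim: u v => [[]|y u IHu [v|v]] /= pv.
  have /eqP v0 : v == troot y by rewrite -parent_None; case: (parent v) pv.
  exists id; split; last by rewrite v0.
  split=> // [|x]; first by exists id.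
  by rewrite omap_id.
have /IHu[phi [[[psi phiK psiK] pphi lphi] phiv]] : fparent v
  = None by case: (fparent v) pv.
exists (fun z : (vertex y + fvertex u)%type =>
  match z with
  | inl a => inr (inl a)
  | inr b => match phi b with inl c => inl c | inr d => inr (inr d) end
  end : (vertex (pick_at v).1 + (vertex y + fvertex (pick_at v).2))%type).
rewrite phiv; split=> //; split.
- exists (fun z : (vertex (pick_at v).1
  + (vertex y + fvertex (pick_at v).2))%type =>
   match z with
   | inl c => inr (psi (inl c))
   | inr (inl a) => inl a
   | inr (inr d) => inr (psi (inr d))
   end) => [[a|b]|[c|[a|d]]] //=; rewrite ?psiK //.
  by case E: (phi b) => /=; rewrite -E phiK.
- move=> [a|b] /=; first by case: (parent a).
  have := pphi b; case: (phi b) => [c|d] /=.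
    by case: (parent c) (fparent b) => [c'|] [b'|] //= [<-].
  by case: (fparent d) (fparent b) => [d'|] [b'|] //= [<-].
move=> [a|b] //=; by have := lphi b; case: (phi b).
Qed.

Definition sum_fun (V V' W W' : finType) (p : {ffun V -> W} * {ffun V' -> W'}) :
    {ffun (V + V')%type -> (W + W')%type} :=
  [ffun v => match v with inl a => inl (p.1 a) | inr b => inr (p.2 b) end].

Lemma sum_fun_inj V V' W W' : injective (@sum_fun V V' W W').
Proof.
move=> [f g] [f' g'] /ffunP E; congr (_, _); apply/ffunP=> v.
  by have := E (inl v); rewrite !ffunE => -[].
by have := E (inr v); rewrite !ffunE => -[].
Qed.

Local Notation fisos s u :=
  (isos (@fparent A s) (@fparent A u) (@flabel A s) (@flabel A u)).

(** A vertex and its parent lie in the same tree, so by induction from the root all of [t] follows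
    its root into [x]. *)
Lemma iso_inl t s x u (f : fvertex (t :: s) -> fvertex (x :: u)) :
  is_iso (@fparent A (t :: s)) (@fparent A (x :: u))
         (@flabel A (t :: s)) (@flabel A (x :: u)) f ->
  f (inl (troot t)) = inl (troot x) -> forall a, exists c, f (inl a) = inl c.
Proof.
move=> [_ pf _] f0; elim/vertex_ind => [|v v' pv [c fv']];
  first by exists (troot x).
have := pf (inl v); rewrite /= pv /= fv'.
by case: (f (inl v)) => [c' _|d]; [exists c' | rewrite /=; case: (fparent d)].
Qed.

(** By [iso_inl] for the isomorphism and for its inverse, both the first tree and the rest are
    respected, so the isomorphism is a disjoint sum of one of trees and one of forests. *)
Lemma card_pinned_cons t s x u :
  #|[set f in fisos (t :: s) (x :: u) | f (inl (troot t)) == inl (troot x)]|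
  = (tcount t x * fcount s u)%N.
Proof.
rewrite -cardsX -(card_imset _ (@sum_fun_inj _ _ _ _)); apply: eq_card => f.
apply/idP/imsetP => [|[[g h] + ->]]; rewrite inE; last first.
  rewrite in_setX ffunE => /andP[/isosP[[g' gK g'K] pg lg]
    /isosP[[h' hK h'K] ph lh]] /=.
  apply/andP; split; last first.
    by apply/eqP; congr inl; apply/eqP; rewrite -parent_None pg parent_troot.
  apply/isosP; split.
  - exists (fun z : (vertex x + fvertex u)%type =>
      match z with inl c => inl (g' c) | inr d => inr (h' d) end :
        (vertex t + fvertex s)%type).
      by move=> [a|b]; rewrite ffunE /= ?gK ?hK.
    by move=> [a|b]; rewrite ffunE /= ?g'K ?h'K.
  - move=> [a|b]; rewrite ffunE /= ?pg ?ph.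
      by case: (parent a) => //= a'; rewrite ffunE.
    by case: (fparent b) => //= b'; rewrite ffunE.
  - by move=> [a|b]; rewrite ffunE /= ?lg ?lh.
move=> /andP[/isosP fi /eqP f0].
have [f' [f'i fK f'K]] := is_iso_inv fi.
have f'0 : f' (inl (troot x)) = inl (troot t) by rewrite -f0 fK.
have fl := iso_inl fi f0; have fl' := iso_inl f'i f'0.
have fr b : exists d, f (inr b) = inr d.
  case E: (f (inr b)) => [c|d]; last by exists d.
  by have [a] := fl' c; rewrite -E fK.
have fr' b : exists d, f' (inr b) = inr d.
  case E: (f' (inr b)) => [c|d]; last by exists d.
  by have [a] := fl c; rewrite -E f'K.
have [[g gE] [h hE]] := (fin_all_exists fl, fin_all_exists fr).
have [[g' gE'] [h' hE']] := (fin_all_exists fl', fin_all_exists fr').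
have [_ pf lf] := fi.
exists (finfun g, finfun h); last first.
  by apply/ffunP=> -[a|b]; rewrite ffunE /= ffunE ?gE ?hE.
rewrite in_setX /=; apply/andP; split; apply/is_iso_ffun; split.
- exists g' => a; first by have := fK (inl a); rewrite gE gE' => -[].
  by have := f'K (inl a); rewrite gE' gE => -[].
- move=> a; have := pf (inl a); rewrite /= gE /=.
  by case: (parent a) (parent (g a)) => [a'|] [b'|] //=; rewrite ?gE // => -[->].
- by move=> a; have := lf (inl a); rewrite gE.
- exists h' => a; first by have := fK (inr a); rewrite hE hE' => -[].
  by have := f'K (inr a); rewrite hE' hE => -[].
- move=> a; have := pf (inr a); rewrite /= hE /=.
  by case: (fparent a) (fparent (h a)) => [a'|] [b'|] //=; rewrite ?hE // => -[->].
- by move=> a; have := lf (inr a); rewrite hE.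
Qed.

Lemma fcount_nil : fcount [::] [::] = 1%N.
Proof.
rewrite /fcount; apply/eqP/cards1P; exists (finfun id).
apply/setP=> f; rewrite inE; have -> : f = finfun id by apply/ffunP=> -[].
by rewrite eqxx is_iso_ffun //; split=> [|[]|[]]; exists id.
Qed.

Lemma fcount_nil_cons y u : fcount [::] (y :: u) = 0%N.
Proof.
apply/eqP; rewrite cards_eq0; apply/eqP/setP=> f; rewrite in_set0.
by apply/negP=> /isosP[[g _ _] _ _]; case: (g (inl (troot y))).
Qed.

(** The isomorphisms are sorted by the image of the root of [t], which is a root of [u]. *)
Lemma fcount_cons t s u :
  fcount (t :: s) u = (\sum_(p <- picks u) tcount t p.1 * fcount s p.2)%N.
Proof.
rewrite -(big_pick_at _ u (fun p => tcount t p.1 * fcount s p.2)%N) /=.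
rewrite /fcount -sum1_card.
rewrite (partition_big (fun f : {ffun _ -> _} => f (inl (troot t)))
          (fun v => fparent v == None)) /= => [|f /isosP[_ pf _]]; last first.
  by rewrite pf /= parent_troot.
apply: eq_bigr => v /eqP /pick_at_iso [phi [iphi phiv]].
rewrite -card_pinned_cons -phiv -(card_pinned_eq _ _ _ _ iphi) -sum1_card.
by apply: eq_bigl => f; rewrite !inE.
Qed.

Lemma tcount_leaf (a b : A) : tcount (PLeaf a) (PLeaf b) = (a == b).
Proof.
rewrite /tcount; have [<-|neq] := eqVneq a b.
  apply/eqP/cards1P; exists (finfun id).
  apply/setP=> f; rewrite inE; have -> : f = finfun id by apply/ffunP=> -[];
    rewrite ffunE; case: (f tt).
  by rewrite eqxx is_iso_ffun //; split=> //; exists id.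
apply/eqP; rewrite cards_eq0; apply/eqP/setP=> f; rewrite in_set0.
by apply/negP=> /isosP[_ _ /(_ tt)] /= [ba]; rewrite ba eqxx in neq.
Qed.

Lemma tcount_leaf_node (a : A) x y : tcount (PLeaf a) (PNode x y) = 0%N.
Proof.
apply/eqP; rewrite cards_eq0; apply/eqP/setP=> f; rewrite in_set0.
apply/negP=> /isosP[_ pf lf]; have := pf tt; have := lf tt.
by case: (f tt) => [[v|v]|].
Qed.

Lemma tcount_node_leaf (a : A) x y : tcount (PNode x y) (PLeaf a) = 0%N.
Proof.
apply/eqP; rewrite cards_eq0; apply/eqP/setP=> f; rewrite in_set0.
by apply/negP=> /isosP[_ _ /(_ None)].
Qed.

Lemma tcount_fcount t x : fcount [:: t] [:: x] = tcount t x.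
Proof. by rewrite fcount_cons /= big_seq1 fcount_nil muln1. Qed.

(** Adds a common root [None]: a former root [v] has [p v = None], now read as its parent. As the
    only vertex without a parent, [None] is fixed by every isomorphism. *)
Definition opt_parent (V : finType) (p : V -> option V) (v : option V) :
    option (option V) := omap p v.

Lemma card_isos_opt (V W : finType) (pV : V -> option V) (pW : W -> option W)
    (lV : V -> option A) (lW : W -> option A) :
  #|isos (opt_parent pV) (opt_parent pW) (obind lV) (obind lW)|
  = #|isos pV pW lV lW|.
Proof.
pose h (f : {ffun V -> W}) := [ffun v => omap f v].
have h_inj : injective h.
  move=> f g /ffunP fg; apply/ffunP=> v; have := fg (Some v).
  by rewrite !ffunE => -[].
rewrite -(card_imset _ h_inj); apply: eq_card => f.
apply/idP/imsetP => [|[g + ->]]; last first.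
  move=> /isosP[[g' gK g'K] pg lg]; apply/isosP; split.
  - by exists (omap g') => -[a|]; rewrite ?ffunE //= ?gK ?g'K // ffunE.
  - by move=> [a|]; rewrite ffunE //= ?pg; case: (pV _) => [b|] /=; rewrite ffunE.
  - by move=> [a|]; rewrite ffunE //= lg.
move=> /isosP fi; have [f' [f'i fK f'K]] := is_iso_inv fi.
have [_ pf lf] := fi; have [_ pf' _] := f'i.
have f0 : f None = None by have := pf None; case: (f None).
have f'0 : f' None = None by have := pf' None; case: (f' None).
have fS v : exists z, f (Some v) = Some z.
  by case E: (f (Some v)) => [w|]; [exists w | move: (fK (Some v)); rewrite E f'0].
have f'S v : exists z, f' (Some v) = Some z.
  by case E: (f' (Some v)) => [w|]; [exists w | move: (f'K (Some v)); rewrite E f0].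
have [[g gE] [g' gE']] := (fin_all_exists fS, fin_all_exists f'S).
exists (finfun g); last by apply/ffunP=> -[a|]; rewrite !ffunE //= ffunE gE.
apply/is_iso_ffun; split.
- exists g' => a; first by have := fK (Some a); rewrite gE gE' => -[].
  by have := f'K (Some a); rewrite gE' gE => -[].
- move=> a; have := pf (Some a); rewrite gE /= => -[->].
  by case: (pV a) => //= b; rewrite gE.
- by move=> a; have := lf (Some a); rewrite gE.
Qed.

Lemma node_iso_opt t t' :
  exists f : vertex (PNode t t') -> option (fvertex [:: t; t']),
    is_iso (@parent A (PNode t t')) (opt_parent (@fparent A [:: t; t']))
           (@label A (PNode t t')) (obind (@flabel A [:: t; t'])) f.
Proof.
exists (omap (fun v : (vertex t + vertex t')%type =>
  match v with inl a => inl a | inr b => inr (inl b) end : fvertex [:: t; t'])).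
split; last by move=> [[a|b]|].
  exists (omap (fun v : fvertex [:: t; t'] =>
   match v with inl a => inl a | inr (inl b) => inr b | inr (inr z) =>
     match z with end
   end : (vertex t + vertex t')%type)); by [move=> [[a|b]|] | move=> [[a|[b|[]]]|]].
by move=> [[a|b]|] //=; case: (parent _).
Qed.

(** Deleting the root leaves forests of two trees, whose isomorphisms either keep or exchange the
    two places. *)
Lemma tcount_node t t' x x' :
  tcount (PNode t t') (PNode x x')
  = (tcount t x * tcount t' x' + tcount t x' * tcount t' x)%N.
Proof.
have <- : fcount [:: t; t'] [:: x; x']
  = (tcount t x * tcount t' x' + tcount t x' * tcount t' x)%N.
  by rewrite fcount_cons /= big_cons big_seq1 !tcount_fcount.
rewrite /fcount -card_isos_opt.
have [f fi] := node_iso_opt t t'; have [g [gi _ _]] := is_iso_inv fi.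
by have [h hi] := node_iso_opt x x'; apply: card_isos_eq gi hi.
Qed.

Lemma ptree_iso_tcount t x : ptree_iso t x = (0 < tcount t x)%N.
Proof. by rewrite card_gt0. Qed.

Lemma tcount_eq t t' x x' : ptree_iso t t' -> ptree_iso x x' -> tcount t x
  = tcount t' x'.
Proof.
rewrite ptree_iso_sym => /ptree_isoP[f fi] /ptree_isoP[g gi].
exact: card_isos_eq fi gi.
Qed.

End Trees.

(** * Admissible cuts *)

Lemma big_option (R : Type) (idx : R) (op : Monoid.com_law idx) (T : finType)
    (P : pred (option T)) (F : option T -> R) :
  \big[op/idx]_(v | P v) F v
  = op (if P None then F None else idx) (\big[op/idx]_(v | P (Some v)) F (Some v)).
Proof.
rewrite ![index_enum _]unlock [@Finite.enum in LHS]unlock /= /option_enum.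
by rewrite big_cons big_map; case: (P None); rewrite ?Monoid.mul1m.
Qed.

Section Cuts.
Variable A : choiceType.
Implicit Types (t l r x : ptree A).

Lemma parent_eq_None t (v : vertex t) : parent v = None -> v = troot t.
Proof. by move=> pv; apply/eqP; rewrite -parent_None pv. Qed.

Lemma subtree_root t : subtree (troot t) = t.
Proof. by case: t. Qed.

(* The pairs (P^C(t), R^C(t)) for C admissible; see [sum_admissible]. *)
Fixpoint cuts t : seq (seq (ptree A) * ptree A) :=
  match t with
  | PLeaf a => [:: ([::], PLeaf a)]
  | PNode l r =>
      [seq (c.1 ++ d.1, PNode c.2 d.2) | c <- cuts l, d <- cuts r]
      ++ [seq (l :: c.1, c.2) | c <- cuts r]
      ++ [seq (r :: c.1, c.2) | c <- cuts l]
  end.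

Lemma eq_remainder t (C D : pred (vertex t)) :
  C =1 D -> remainder C = remainder D.
Proof.
elim: t C D => //= l IHl r IHr C D CD; rewrite !CD.
by rewrite (IHl _ (fun u => D (Some (inl u)))) //
  (IHr _ (fun u => D (Some (inr u)))).
Qed.

Lemma belowE t (v w : vertex t) :
  below v w = (v == w) || (if parent w is Some w' then below v w' else false).
Proof.
apply/idP/orP => [/connectP[p]|[/eqP->|]]; last 2 first.
- exact: connect0.
- case E: (parent w) => [w'|] // vw'; apply: connect_trans vw' _.
  by apply: connect1; rewrite E.
case/lastP: p => [_ ->|p x]; first by left.
rewrite rcons_path last_rcons => /andP[vp /eqP pw] ->; right.
by rewrite pw; apply/connectP; exists p.
Qed.

Lemma below_root t (w : vertex t) : below (troot t) w.
Proof.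
elim/vertex_ind: w => [|v v' pv IH]; first by rewrite belowE eqxx.
by rewrite belowE pv IH orbT.
Qed.

Section Node.
Variables l r : ptree A.
Local Notation inlv v := (Some (inl v) : vertex (PNode l r)).
Local Notation inrv v := (Some (inr v) : vertex (PNode l r)).

Lemma below_inl (v w : vertex l) : below (inlv v) (inlv w) = below v w.
Proof.
elim/vertex_ind: w => [|w w' pw IH]; rewrite [LHS]belowE [RHS]belowE /=.
  by rewrite parent_troot /= [below (t := PNode l r) _ None]belowE.
by rewrite pw /= IH.
Qed.

Lemma below_inr (v w : vertex r) : below (inrv v) (inrv w) = below v w.
Proof.
elim/vertex_ind: w => [|w w' pw IH]; rewrite [LHS]belowE [RHS]belowE /=.
  by rewrite parent_troot /= [below (t := PNode l r) _ None]belowE.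
by rewrite pw /= IH.
Qed.

Lemma below_inl_inr (v : vertex l) (w : vertex r) : below (inlv v) (inrv w) = false.
Proof.
elim/vertex_ind: w => [|w w' pw IH]; rewrite belowE /=.
  by rewrite parent_troot /= belowE.
by rewrite pw /= IH.
Qed.

Lemma below_inr_inl (v : vertex r) (w : vertex l) : below (inrv v) (inlv w) = false.
Proof.
elim/vertex_ind: w => [|w w' pw IH]; rewrite belowE /=.
  by rewrite parent_troot /= belowE.
by rewrite pw /= IH.
Qed.
End Node.

Lemma leaf_below t (v : vertex t) : exists2 w :
  vertex t, label w != None & below v w.
Proof.
elim: t v => [a|l IHl r IHr] v; first by exists tt; rewrite // belowE; case: v.
case: v => [[v|v]|].
- by have [w lw vw] := IHl v; exists (Some (inl w)); rewrite // below_inl.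
- by have [w lw vw] := IHr v; exists (Some (inr w)); rewrite // below_inr.
by have [w lw _] := IHl (troot l); exists (Some (inl w));
  rewrite // (below_root (t := PNode l r)).
Qed.

(* An independent set is either admissible or [[set troot t]], which stands for
   the cut of the edge above [t] when [t] is a proper subtree. *)
Definition independent t (C : {set vertex t}) : bool :=
  [forall w, forall e in C, forall f in C,
     [&& label w != None, below e w & below f w] ==> (e == f)]
  && [forall e in C, forall f in C, (parent e == parent f) ==> (e == f)].

Lemma independentP t (C : {set vertex t}) :
  reflect ((forall w e f, e \in C -> f \in C -> label w != None ->
              below e w -> below f w -> e = f)
           /\ (forall e f, e \in C -> f \in C -> parent e = parent f -> e = f))
          (independent C).
Proof.
apply: (iffP andP) => -[H1 H2]; split.
- move=> w e f eC fC lw ew fw; apply/eqP.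
  move/forallP/(_ w)/forall_inP/(_ e eC)/forall_inP/(_ f fC): H1.
  by rewrite lw ew fw.
- move=> e f eC fC /eqP ef; apply/eqP.
  by move/forall_inP/(_ e eC)/forall_inP/(_ f fC): H2; rewrite ef.
- apply/forallP=> w; apply/forall_inP=> e eC; apply/forall_inP=> f fC.
  by apply/implyP=> /and3P[lw ew fw]; apply/eqP/(H1 w).
apply/forall_inP=> e eC; apply/forall_inP=> f fC.
by apply/implyP=> /eqP ef; apply/eqP/H2.
Qed.

Lemma admissibleE t (C : {set vertex t}) :
  admissible C = (troot t \notin C) && independent C.
Proof.
congr andb; apply/subsetP/idP => [sC|rC v vC].
  by apply/negP=> /sC; rewrite !inE eqxx.
by rewrite !inE; apply: contraNneq rC => <-.
Qed.

(** A leaf below [v] is also below the root, so the path condition identifies any [v] in [C] with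
    the root. *)
Lemma independent_root t (C : {set vertex t}) :
  independent C && (troot t \in C) = (C == [set troot t]).
Proof.
apply/andP/eqP => [[/independentP[H1 _] rC]|->]; last first.
  rewrite set11; split=> //; apply/independentP.
  by split=> [w|] e f /set1P-> /set1P->.
apply/setP=> v; rewrite in_set1; apply/idP/eqP => [vC|-> //].
have [w lw vw] := leaf_below v; apply: (H1 w) => //; exact: below_root.
Qed.

Definition join_sets l r (p : {set vertex l} * {set vertex r}) :
    {set vertex (PNode l r)} :=
  [set v | match v with
           | None => false
           | Some (inl a) => a \in p.1
           | Some (inr b) => b \in p.2
           end].

(** No leaf lies below both a vertex of [l] and one of [r], so the path condition splits. The parent
    condition splits too, except at the new root, where it gives the last conjunct. *)
Lemma admissible_join l r (p : {set vertex l} * {set vertex r}) :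
  admissible (join_sets p)
  = [&& independent p.1, independent p.2
      & ~~ ((troot l \in p.1) && (troot r \in p.2))].
Proof.
rewrite admissibleE in_set /=.
apply/independentP/and3P =>
  [[H1 H2]|[/independentP[L1 L2] /independentP[R1 R2] nLR]].
  split.
  - apply/independentP; split=> [w|] e f eC fC.
      move=> lw ew fw.
      have := H1 (Some (inl w)) (Some (inl e)) (Some (inl f)).
      by rewrite !inE !below_inl => /(_ eC fC lw ew fw) [].
    move=> ef; have := H2 (Some (inl e)) (Some (inl f)).
    by rewrite !inE /= ef => /(_ eC fC erefl) [].
  - apply/independentP; split=> [w|] e f eC fC.
      move=> lw ew fw.
      have := H1 (Some (inr w)) (Some (inr e)) (Some (inr f)).
      by rewrite !inE !below_inr => /(_ eC fC lw ew fw) [].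
    move=> ef; have := H2 (Some (inr e)) (Some (inr f)).
    by rewrite !inE /= ef => /(_ eC fC erefl) [].
  apply/negP=> /andP[lC rC].
  have := H2 (Some (inl (troot l))) (Some (inr (troot r))).
  by rewrite !inE /= !parent_troot => /(_ lC rC erefl).
split.
  move=> [[w|w]|] // [[e|e]|] [[f|f]|]; rewrite !inE //= => eC fC lw;
    rewrite ?below_inl ?below_inr ?below_inl_inr ?below_inr_inl //.
    by move=> ew fw; rewrite (L1 w e f).
  by move=> ew fw; rewrite (R1 w e f).
move=> [[e|e]|] [[f|f]|]; rewrite !inE //= => eC fC.
- move=> ef; rewrite (L2 e f) //.
  by case: (parent e) (parent f) ef => [?|] [?|] // [->].
- case pe: (parent e) => [?|]; case pf: (parent f) => [?|] //= _.
  by move: nLR; rewrite -(parent_eq_None pe) -(parent_eq_None pf) eC fC.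
- case pe: (parent e) => [?|]; case pf: (parent f) => [?|] //= _.
  by move: nLR; rewrite -(parent_eq_None pe) -(parent_eq_None pf) eC fC.
move=> ef; rewrite (R2 e f) //.
by case: (parent e) (parent f) ef => [?|] [?|] // [->].
Qed.

Section SumCuts.
Variables (K : comPzRingType) (M : nmodType) (wt : ptree A -> K).

Lemma prod_join_sets l r (p : {set vertex l} * {set vertex r}) :
  \prod_(e in join_sets p) wt (subtree e)
  = \prod_(e in p.1) wt (subtree e) * \prod_(e in p.2) wt (subtree e).
Proof.
rewrite [LHS](@big_option _ _ _ (vertex l + vertex r)%type) big_sumType /= !inE
  mul1r.
by congr (_ * _); apply: eq_bigl => v; rewrite inE.
Qed.

Lemma remainder_join l r (p : {set vertex l} * {set vertex r}) :
  remainder (t := PNode l r) (mem (join_sets p))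
  = if troot l \in p.1 then remainder (mem p.2)
    else if troot r \in p.2 then remainder (mem p.1)
    else PNode (remainder (mem p.1)) (remainder (mem p.2)).
Proof.
have El u : (Some (inl u) \in join_sets p) = (u \in p.1) by rewrite inE.
have Er u : (Some (inr u) \in join_sets p) = (u \in p.2) by rewrite inE.
rewrite [LHS]/= El Er.
by rewrite (eq_remainder (D := mem p.1) El) (eq_remainder (D := mem p.2) Er).
Qed.

Lemma sum_admissible t (F : K -> ptree A -> M) :
  \sum_(C : {set vertex t} | admissible C)
     F (\prod_(e in C) wt (subtree e)) (remainder (mem C))
  = \sum_(c <- cuts t) F (\prod_(x <- c.1) wt x) c.2.
Proof.
elim: t F => [a|l IHl r IHr] F.
  rewrite /= big_seq1 big_nil (big_pred1 set0) ?big_set0 // => C.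
  rewrite admissibleE; apply/andP/eqP => [[rC _]|->].
    by apply/setP=> -[]; rewrite inE; apply/negbTE.
  by rewrite inE; split=> //; apply/independentP; split=> [w|] e f; rewrite inE.
rewrite [RHS]big_cat big_cat /= big_allpairs_dep /= !big_map /=.
pose h := @join_sets l r.
pose h' (C : {set vertex (PNode l r)}) :=
  ([set a | Some (inl a) \in C], [set b | Some (inr b) \in C]).
(* [h'] inverts [h] on the sets that avoid the root, and admissible sets do. *)
rewrite (reindex_onto h h') /=; last first.
  move=> C /[!admissibleE] /andP[rC _]; apply/setP=> -[[v|v]|]; rewrite !inE //.
  exact/esym/negbTE.
transitivity (\sum_(p : {set vertex l} * {set vertex r}
    | [&& independent p.1, independent p.2
      & ~~ ((troot l \in p.1) && (troot r \in p.2))])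
  F (\prod_(e in p.1) wt (subtree e) * \prod_(e in p.2) wt (subtree e))
    (if troot l \in p.1 then remainder (mem p.2)
    else if troot r \in p.2 then remainder (mem p.1)
    else PNode (remainder (mem p.1)) (remainder (mem p.2)))).
  apply: eq_big => p => [|_]; last by rewrite -prod_join_sets -remainder_join.
  rewrite -admissible_join; apply: andb_idr => _; apply/eqP.
  by case: p => p q; congr (_, _); apply/setP=> v; rewrite !inE.
pose G (C : {set vertex l}) (D : {set vertex r}) :=
  F (\prod_(e in C) wt (subtree e) * \prod_(e in D) wt (subtree e))
    (if troot l \in C then remainder (mem D)
     else if troot r \in D then remainder (mem C)
     else PNode (remainder (mem C)) (remainder (mem D))).
rewrite (bigID (fun p : {set vertex l} * {set vertex r} => troot l \in p.1)) /=.
rewrite [X in _ + X](bigID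
  (fun p : {set vertex l} * {set vertex r} => troot r \in p.2)) /=.
rewrite addrA addrC; congr (_ + (_ + _)).
- transitivity (\sum_(C | admissible C) \sum_(D | admissible D) G C D).
    rewrite pair_big; apply: eq_bigl => -[C D] /=; rewrite !admissibleE.
    by case: (troot l \in C); case: (troot r \in D); rewrite ?andbF ?andbT.
  transitivity (\sum_(c <- cuts l) \sum_(d <- cuts r)
      F (\prod_(x <- c.1) wt x * \prod_(x <- d.1) wt x) (PNode c.2 d.2)).
    rewrite -[RHS](IHl (fun a R => \sum_(d <- cuts r)
      F (a * \prod_(x <- d.1) wt x) (PNode R d.2))).
    apply: eq_bigr => C; rewrite admissibleE => /andP[/negbTE rC _].
    rewrite -[RHS](IHr (fun b R =>
      F (\prod_(e in C) wt (subtree e) * b) (PNode (remainder (mem C)) R))).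
    apply: eq_bigr => D; rewrite admissibleE => /andP[/negbTE rD _].
    by rewrite /G rC rD.
  by apply: eq_bigr => c _; apply: eq_bigr => d _; rewrite big_cat.
(* The edge above [l] is cut: independence forces [C] to be [[set troot l]], and the parent
   condition at the root makes [D] admissible. *)
- transitivity (\sum_(C : {set vertex l} | C == [set troot l])
  \sum_(D | admissible D) G C D).
    rewrite pair_big; apply: eq_bigl => -[C D] /=;
      rewrite admissibleE -independent_root.
    by case: (troot l \in C); case: (troot r \in D); rewrite ?andbF ?andbT.
  rewrite big_pred1_eq; under [RHS]eq_bigr do rewrite big_cons.
  rewrite -[RHS](IHr (fun b R => F (wt l * b) R)).
  by apply: eq_bigr => D _; rewrite /G set11 big_set1 subtree_root.
transitivity (\sum_(C | admissible C)
  \sum_(D : {set vertex r} | D == [set troot r]) G C D).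
  rewrite pair_big; apply: eq_bigl => -[C D] /=;
    rewrite admissibleE -independent_root.
  by case: (troot l \in C); case: (troot r \in D); rewrite ?andbF ?andbT.
under [RHS]eq_bigr do rewrite big_cons.
rewrite -[RHS](IHl (fun b R => F (wt r * b) R)).
apply: eq_bigr => C; rewrite admissibleE => /andP[/negbTE rC _].
by rewrite big_pred1_eq /G set11 rC big_set1 subtree_root mulrC.
Qed.
End SumCuts.
End Cuts.

(** * Cuts of a single edge and classes of trees *)

Section SimpleCuts.
Variable A : choiceType.
Implicit Types (t l r x : ptree A) (T : tree A).

(* The pairs (P^e(t), R^e(t)) for e an edge. *)
Fixpoint edge_cuts t : seq (ptree A * ptree A) :=
  match t with
  | PLeaf _ => [::]
  | PNode l r =>
      (l, r) :: (r, l)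
        :: [seq (e.1, PNode e.2 r) | e <- edge_cuts l]
           ++ [seq (e.1, PNode l e.2) | e <- edge_cuts r]
  end.

Lemma graft_root s t : graft s (troot t) = PNode t s.
Proof. by case: t. Qed.

(** An isomorphism from a graft of [s] on [t] to [x] sends the edge carrying [s] to an edge e of
    [x], and amounts to isomorphisms from [s] to P^e(x) and from [t] to R^e(x). The vertex [troot t]
    accounts for M(t, s). *)
Lemma tcount_graft s t x :
  (\sum_(v : vertex t) tcount (graft s v) x
   = \sum_(e <- edge_cuts x) tcount s e.1 * tcount t e.2)%N.
Proof.
elim: x t => [a|l IHl r IHr] t /=.
  rewrite big_nil big1 // => v _.
  by case: t v => [b|t1 t2] [] => [|[]|] *; rewrite tcount_node_leaf.
rewrite !big_cons big_cat !big_map /=.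
case: t => [b|t1 t2].
  rewrite (big_pred1 tt) /= => [|[]//]; rewrite tcount_node.
  rewrite [X in _ = (_ + (_ + (X + _)))%N]big1 => [|e _];
    last by rewrite tcount_leaf_node muln0.
  rewrite [X in _ = (_ + (_ + (_ + X)))%N]big1 => [|e _];
    last by rewrite tcount_leaf_node muln0.
  by rewrite !addn0 addnC ![(tcount s _ * _)%N]mulnC.
(* The term of [None], which is M(t, s), matches the two root edges of [x]; grafts inside [t1] or
   [t2] match the edges inside [l] or [r]. *)
rewrite [LHS](@big_option _ _ _ (vertex t1 + vertex t2)%type) /= big_sumType /=.
rewrite tcount_node addnC [in RHS]addnA addnC; congr (_ + _)%N.
  by rewrite addnC ![(tcount s _ * _)%N]mulnC.
under eq_bigr do rewrite tcount_node.
under [X in (_ + X)%N]eq_bigr do rewrite tcount_node.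
rewrite !big_split /= -!big_distrl -!big_distrr /= !IHl !IHr.
under [X in _ = (X + _)%N]eq_bigr do rewrite tcount_node mulnDr.
under [X in _ = (_ + X)%N]eq_bigr do rewrite tcount_node mulnDr.
rewrite !big_split /= !big_distrl !big_distrr /=.
rewrite addnACA [in RHS]addnACA [X in _ = (_ + X)%N]addnC.
congr (_ + _ + (_ + _))%N; apply: eq_bigr => e _; rewrite ?mulnA //;
  by congr (_ * _)%N; rewrite mulnC.
Qed.

Definition ptree_class t : tree A := (\pi_(tree A) t)%qT.

Lemma ptree_class_eq t x : (ptree_class t = ptree_class x) <-> ptree_iso t x.
Proof. by split=> [/eqmodP|tx]; last exact/eqmodP. Qed.

Definition tnode (T U : tree A) : tree A := ptree_class (PNode (repr T) (repr U)).

Lemma ptree_class_repr (T : tree A) : ptree_class (repr T) = T.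
Proof. exact: reprK. Qed.

Lemma iso_repr t : ptree_iso (repr (ptree_class t)) t.
Proof. by apply/ptree_class_eq; rewrite ptree_class_repr. Qed.

Lemma ptree_class_node l r : ptree_class (PNode l r)
  = tnode (ptree_class l) (ptree_class r).
Proof.
apply/ptree_class_eq; rewrite ptree_iso_sym ptree_iso_tcount tcount_node.
by rewrite addn_gt0 muln_gt0 -!ptree_iso_tcount !iso_repr.
Qed.

Lemma tnodeC : commutative tnode.
Proof.
move=> T U; apply/ptree_class_eq; rewrite ptree_iso_tcount tcount_node.
by rewrite addn_gt0 !muln_gt0 -!ptree_iso_tcount !ptree_iso_refl orbT.
Qed.

Lemma ptree_iso_leaf (a : A) x : ptree_iso (PLeaf a) x -> x = PLeaf a.
Proof.
rewrite ptree_iso_tcount; case: x => [b|l' r']; last by rewrite tcount_leaf_node.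
by rewrite tcount_leaf; case: eqVneq => [->|].
Qed.

Lemma ptree_iso_node l r x : ptree_iso (PNode l r) x ->
  exists l' r', [/\ ptree_iso l l', ptree_iso r r'
                  & x = PNode l' r' \/ x = PNode r' l'].
Proof.
rewrite ptree_iso_tcount; case: x => [b|l' r']; first by rewrite tcount_node_leaf.
rewrite tcount_node addn_gt0 !muln_gt0 -!ptree_iso_tcount => /orP[] /andP[? ?].
  by exists l', r'; split=> //; left.
by exists r', l'; split=> //; right.
Qed.

(** * Invariance of cut sums under isomorphism *)

Section Invariance.
Variables (K : comPzRingType) (M : nmodType) (wt : tree A -> K).

Definition cut_sum (F : K -> tree A -> M) t : M :=
  \sum_(c <- cuts t) F (\prod_(x <- c.1) wt (ptree_class x)) (ptree_class c.2).

Lemma cut_sum_node (F : K -> tree A -> M) l r :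
  cut_sum F (PNode l r)
  = cut_sum (fun a R => cut_sum (fun b S => F (a * b) (tnode R S)) r) l
    + (cut_sum (fun b => F (wt (ptree_class l) * b)) r
       + cut_sum (fun a => F (wt (ptree_class r) * a)) l).
Proof.
rewrite /cut_sum big_cat big_cat /= big_allpairs_dep !big_map /=.
congr (_ + (_ + _)); apply: eq_bigr => c _; rewrite ?big_cons //.
by apply: eq_bigr => d _; rewrite big_cat ptree_class_node.
Qed.

Lemma cut_sum_nodeC (F : K -> tree A -> M) l r :
  cut_sum F (PNode l r) = cut_sum F (PNode r l).
Proof.
rewrite !cut_sum_node [X in _ + X]addrC; congr (_ + _).
rewrite /cut_sum exchange_big /=; apply: eq_bigr => c _; apply: eq_bigr => d _.
by rewrite mulrC tnodeC.
Qed.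

Lemma eq_cut_sum (F G : K -> tree A -> M) t :
  (forall a R, F a R = G a R) -> cut_sum F t = cut_sum G t.
Proof. by move=> FG; apply: eq_bigr => c _. Qed.

(** The recursion [cut_sum_node] involves the subtrees only through their classes and their cut
    sums, and exchanging them changes nothing because [K] and [tnode] are commutative. *)
Lemma cut_sum_iso (F : K -> tree A -> M) t x :
  ptree_iso t x -> cut_sum F t = cut_sum F x.
Proof.
elim: t x F => [a|l IHl r IHr] x F; first by move/ptree_iso_leaf->.
move=> /ptree_iso_node[l' [r' [ll' rr' xE]]].
transitivity (cut_sum F (PNode l' r')); last by case: xE => ->;
  rewrite // cut_sum_nodeC.
rewrite !cut_sum_node !(IHl _ _ ll') (IHr _ _ rr').
have /ptree_class_eq -> := ll'; have /ptree_class_eq -> := rr'.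
by congr (_ + _); apply: eq_cut_sum => a R; rewrite (IHr _ _ rr').
Qed.

End Invariance.

Section EdgeInvariance.
Variable N : nmodType.

Definition edge_cut_sum (F : tree A -> tree A -> N) t : N :=
  \sum_(e <- edge_cuts t) F (ptree_class e.1) (ptree_class e.2).

Lemma edge_cut_sum_node (F : tree A -> tree A -> N) l r :
  edge_cut_sum F (PNode l r)
  = F (ptree_class l) (ptree_class r) + F (ptree_class r) (ptree_class l)
    + (edge_cut_sum (fun Q R => F Q (tnode R (ptree_class r))) l
       + edge_cut_sum (fun Q R => F Q (tnode (ptree_class l) R)) r).
Proof.
rewrite /edge_cut_sum !big_cons big_cat !big_map /= addrA.
by congr (_ + (_ + _)); apply: eq_bigr => e _; rewrite ptree_class_node.
Qed.

Lemma edge_cut_sum_nodeC (F : tree A -> tree A -> N) l r :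
  edge_cut_sum F (PNode l r) = edge_cut_sum F (PNode r l).
Proof.
rewrite !edge_cut_sum_node; congr (_ + _); rewrite addrC //.
by congr (_ + _); apply: eq_bigr => e _; rewrite tnodeC.
Qed.

Lemma edge_cut_sum_iso (F : tree A -> tree A -> N) t x :
  ptree_iso t x -> edge_cut_sum F t = edge_cut_sum F x.
Proof.
elim: t x F => [a|l IHl r IHr] x F; first by move/ptree_iso_leaf->.
move=> /ptree_iso_node[l' [r' [ll' rr' xE]]].
transitivity (edge_cut_sum F (PNode l' r')).
  rewrite !edge_cut_sum_node !(IHl _ _ ll') (IHr _ _ rr').
  by have /ptree_class_eq -> := ll'; have /ptree_class_eq -> := rr'.
by case: xE => ->; rewrite // edge_cut_sum_nodeC.
Qed.

End EdgeInvariance.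

(** * Derivations acting on the pruned part of a cut *)

Section Derivation.
Variables (k : fieldType) (K : comAlgType k) (V : lmodType k).
Variables (wt : tree A -> K) (D : K -> K) (c : tree A -> k).
Hypothesis DM : forall a b, D (a * b) = D a * b + a * D b.
Hypothesis Dwt : forall t, D (wt (ptree_class t))
  = (c (ptree_class t))%:A + edge_cut_sum (fun Q R => c Q *: wt R) t.

(* This is (D (x) id) o delta = delta o edge_cuts, where delta t is the sum of the
   P^C(t) (x) R^C(t).  A general [h], linear in its first argument, replaces
   the tensor in order to absorb the factors coming from the sibling subtree. *)
Lemma cut_sum_derivation (h : K -> tree A -> V) t :
  (forall R, linear (h^~ R)) ->
  cut_sum wt (fun a R => h (D a) R) t
  = \sum_(e <- edge_cuts t) c (ptree_class e.1) *: cut_sum wt h e.2.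
Proof.
have D1 : D 1 = 0.
  by apply: (addIr (D 1)); rewrite add0r -[in RHS](mulr1 1) DM mulr1 mul1r.
have hD (g : K -> tree A -> V) : (forall R, linear (g^~ R)) ->
    forall a b R, g (a + b) R = g a R + g b R.
  by move=> g_lin a b R; have := g_lin R 1 a b; rewrite !scale1r.
have h0 (g : K -> tree A -> V) : (forall R, linear (g^~ R)) -> forall R, g 0 R = 0.
  by move=> g_lin R; apply: (addIr (g 0 R)); rewrite -(hD g g_lin) !add0r.
have hZ (g : K -> tree A -> V) : (forall R, linear (g^~ R)) ->
    forall a y R, g (a *: y) R = a *: g y R.
  by move=> g_lin a y R; have := g_lin R a y 0; rewrite h0 // !addr0.
elim: t h => [a|l IHl r IHr] h h_lin.
  by rewrite /cut_sum /= big_seq1 !big_nil D1 h0.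
have wl_lin (y : K) (U : tree A -> tree A) (g : K -> tree A -> V) :
    (forall R, linear (g^~ R)) -> forall R, linear (fun a => g (y * a) (U R)).
  by move=> g_lin R a b z /=; rewrite mulrDr hD // -scalerAr hZ.
have cut_lin (wr : K -> tree A -> K -> tree A -> V) x :
    (forall b S R, linear (fun a => wr a R b S)) ->
    forall R, linear (fun a => cut_sum wt (wr a R) x).
  move=> w_lin R a y z; rewrite /cut_sum scaler_sumr -big_split /=.
  by apply: eq_bigr => d _; apply: w_lin.
(* The constant in [Dwt] matches the edge cut that removes [s] from the node with subtrees [s] and
   [x]. The other terms match an edge cut inside [s], followed by cutting off what is left of
   [s]. *)
have Dstep s x : cut_sum wt (fun b => h (D (wt (ptree_class s) * b))) x
    = c (ptree_class s) *: cut_sum wt h x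
      + \sum_(e <- edge_cuts s) c (ptree_class e.1)
          *: cut_sum wt (fun b => h (wt (ptree_class e.2) * b)) x
      + cut_sum wt (fun b R => h (wt (ptree_class s) * D b) R) x.
  rewrite /cut_sum scaler_sumr;
    under [X in _ + X + _]eq_bigr do rewrite scaler_sumr.
  rewrite exchange_big -!big_split /=; apply: eq_bigr => d _.
  rewrite DM hD // Dwt mulrDl hD // -scalerAl mul1r hZ //; congr (_ + _ + _).
  rewrite /edge_cut_sum mulr_suml.
  rewrite (big_morph (h^~ _) (id1 := 0) (op1 := +%R)) => [|a b|]; last 2 first.
  - exact: hD.
  - exact: h0.
  by apply: eq_bigr => e _; rewrite -scalerAl hZ.
rewrite cut_sum_node !Dstep (IHr (fun b => h (wt (ptree_class l) * b)));
  last exact: (wl_lin _ id).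
rewrite (IHl (fun b => h (wt (ptree_class r) * b))); last exact: (wl_lin _ id).
have -> : cut_sum wt (fun a R =>
  cut_sum wt (fun b S => h (D (a * b)) (tnode R S)) r) l
    = cut_sum wt (fun a R => cut_sum wt (fun b S => h (D a * b) (tnode R S)) r) l
      + cut_sum wt (fun a R => cut_sum wt (fun b S => h (a * D b) (tnode R S)) r) l.
  rewrite /cut_sum -big_split; apply: eq_bigr => d _ /=.
  by rewrite -big_split; apply: eq_bigr => d' _ /=; rewrite DM hD.
rewrite (IHl (fun a R => cut_sum wt (fun b S => h (a * b) (tnode R S)) r));
  last first.
  apply: (cut_lin (fun a R b S => h (a * b) (tnode R S))) => b S R a y z /=.
  by rewrite mulrDl hD // -scalerAl hZ.
have -> : cut_sum wt (fun a R =>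
  cut_sum wt (fun b S => h (a * D b) (tnode R S)) r) l
   = \sum_(e <- edge_cuts r) c (ptree_class e.1) *:
       cut_sum wt (fun a R => cut_sum wt (fun b S => h (a * b) (tnode R S)) e.2) l.
  rewrite {1}/cut_sum; under [RHS]eq_bigr do rewrite scaler_sumr.
  rewrite [RHS]exchange_big /=; apply: eq_bigr => d _.
  by rewrite (IHr (fun b S => h (_ * b) (tnode _ S))) //; apply: wl_lin.
rewrite /= !big_cons big_cat !big_map /=.
under [X in _ = _ + (_ + (X + _))]eq_bigr do rewrite cut_sum_node !scalerDr.
under [X in _ = _ + (_ + (_ + X))]eq_bigr do rewrite cut_sum_node !scalerDr.
rewrite !big_split /=.
(* Eight sums on each side: one for each root edge and, for the edges inside each subtree, one for
   each of the three kinds of cut of the remaining node. *)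
by rewrite [LHS](AC (2*(3*3)) (3*(6*((1*(4*8))*(2*(5*7)))))).
Qed.
End Derivation.

End SimpleCuts.

(** * Free commutative algebras *)

Section Linear.
Variables (R : pzRingType) (U V : lmodType R) (E : U -> V).
Hypothesis E_lin : linear E.

Lemma lin0 : E 0 = 0.
Proof. by rewrite -[0 in LHS](addNr 0) -scaleN1r E_lin scaleN1r addNr. Qed.

Lemma linD x y : E (x + y) = E x + E y.
Proof. by rewrite -[x in LHS]scale1r E_lin scale1r. Qed.

Lemma linZ c x : E (c *: x) = c *: E x.
Proof. by rewrite -[c *: x]addr0 E_lin lin0 addr0. Qed.

Lemma linB x y : E (x - y) = E x - E y.
Proof. by rewrite linD -scaleN1r linZ scaleN1r. Qed.

Lemma lin_sum (J : Type) (r : seq J) (P : pred J) (F : J -> U) :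
  E (\sum_(j <- r | P j) F j) = \sum_(j <- r | P j) E (F j).
Proof. exact: (big_morph E linD lin0). Qed.

End Linear.

Section LinearExtensions.
Variable k : fieldType.

Section Linext.
Variables (K : choiceType) (V : lmodType k).
Implicit Types (f : K -> V) (x : {malg k[K]}).

Lemma linextEw (D : {fset K}) f x : (msupp x `<=` D)%fset ->
  linext f x = \sum_(i <- D) x@_i *: f i.
Proof.
move=> sub; rewrite /linext (big_fset_incl _ sub) // => i _ /mcoeff_outdom->.
by rewrite scale0r.
Qed.

Lemma linext_is_linear f : linear (linext f).
Proof.
move=> c x y; pose D := (msupp (c *: x + y) `|` (msupp x `|` msupp y))%fset.
have sxy : (msupp (c *: x + y) `<=` D)%fset by exact: fsubsetUl.
have sx : (msupp x `<=` D)%fset by rewrite fsubsetU // fsubsetUl orbT.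
have sy : (msupp y `<=` D)%fset by rewrite fsubsetU // fsubsetUr orbT.
rewrite (linextEw _ sxy) (linextEw _ sx) (linextEw _ sy).
rewrite scaler_sumr -big_split /=; apply: eq_bigr => i _.
by rewrite mcoeffD mcoeffZ scalerDl scalerA.
Qed.

Lemma linextU f i : linext f << i >> = f i.
Proof. by rewrite /linext msuppU oner_eq0 big_seq_fset1 mcoeffUU scale1r. Qed.

Lemma malg_lin_ind (P : {malg k[K]} -> Prop) :
  (forall i, P << i >>) -> P 0 ->
  (forall c x y, P x -> P y -> P (c *: x + y)) -> forall x, P x.
Proof.
move=> PU P0 PD x; rewrite [x]monalgE; elim/big_rec: _ => // i y _ Py.
suff -> : << x@_i *g i >> = x@_i *: << i >> :> {malg k[K]} by apply: PD.
by apply/malgP=> j; rewrite mcoeffZ !mcoeffU mulr_natr.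
Qed.

End Linext.

End LinearExtensions.

(* Working with an arbitrary model of the monoid algebra, rather than with
   [{malg k[M]}] itself, keeps unification from unfolding its operations. *)
Record monoid_algebra (k : fieldType) (M : conomType) := MonoidAlgebra {
  carrier :> comAlgType k;
  basis : M -> carrier;
  extend : forall V : lmodType k, (M -> V) -> carrier -> V;
  basis1 : basis mone = 1;
  basisM : forall m n, basis m * basis n = basis (mmul m n);
  extendP : forall (V : lmodType k) (f : M -> V) c x y,
    extend f (c *: x + y) = c *: extend f x + extend f y;
  extendU : forall (V : lmodType k) (f : M -> V) m, extend f (basis m) = f m;
  basis_ind : forall P : carrier -> Prop,
    (forall m, P (basis m)) -> P 0 ->
    (forall c x y, P x -> P y -> P (c *: x + y)) -> forall x, P x
}.

Arguments extend {k M} _ {V}.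
Arguments extendP {k M _ V} f c x y.
Arguments extendU {k M _ V} f _.

Lemma malg_basisM (k : fieldType) (M : conomType) (m n : M) :
  << m >> * << n >> = << mmul m n >> :> {malg k[M]}.
Proof.
have -> : << m >> * << n >>
  = fgmul << m >> << n >> :> {malg k[M]} by exact: malgM_def.
by rewrite fgmulUU mulr1.
Qed.

Definition malg_algebra (k : fieldType) (M : conomType) : monoid_algebra k M :=
  @MonoidAlgebra k M {malg k[M]} (fun m => << m >>) (fun V f x => linext f x)
    erefl (@malg_basisM k M) (fun V f => linext_is_linear f)
    (fun V f m => linextU f m) (@malg_lin_ind k M).

Section SymTheory.
Variables (k : fieldType) (I : choiceType).
Variable S : monoid_algebra k {cmonom I}.
Local Notation ofmon := (@basis k _ S).
Local Notation lext := (extend S).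
Implicit Types (s u : seq I) (m n : {cmonom I}) (x y : S).

Definition generator (i : I) : S := ofmon (ucm i).

Definition cprod s : {cmonom I} := \big[mmul/mone]_(i <- s) ucm i.

Definition mon s : S := \prod_(i <- s) generator i.

Lemma monE s : mon s = ofmon (cprod s).
Proof.
rewrite /mon /cprod; elim: s => [|i s IH]; first by rewrite !big_nil basis1.
rewrite !big_cons IH basisM; reflexivity.
Qed.

Lemma mon_nil : mon [::] = 1. Proof. exact: big_nil. Qed.
Lemma mon_cons i s : mon (i :: s)
  = generator i * mon s. Proof. exact: big_cons. Qed.
Lemma mon_cat s u : mon (s ++ u) = mon s * mon u. Proof. exact: big_cat. Qed.
Lemma mon1 i : mon [:: i] = generator i. Proof. exact: big_seq1. Qed.

Lemma perm_mon s u : perm_eq s u -> mon s = mon u.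
Proof. exact: perm_big. Qed.

Lemma cprodE s i : cprod s i = count_mem i s.
Proof.
rewrite /cprod; elim: s => [|j s IH] /=; first by rewrite big_nil cm1.
by rewrite big_cons cmM cmU IH.
Qed.

Lemma count_mon_seq m i : count_mem i (mon_seq m) = m i.
Proof.
rewrite /mon_seq count_flatten -map_comp sumnE big_map /=.
under eq_bigr do rewrite count_nseq /=.
case: (boolP (i \in finsupp m)) => im.
  rewrite (big_rem i) //= eqxx mul1n big_seq big1 ?addn0 // => j.
  by rewrite mem_rem_uniq // inE eq_sym => /andP[/negbTE ->].
rewrite big_seq big1 => [|j jm]; first by apply/esym/eqP; rewrite cmE_eq0.
by rewrite (_ : _ == _ = false) //; apply: contraNF im => /eqP <-.
Qed.

Lemma cprod_mon_seq m : cprod (mon_seq m) = m.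
Proof. by apply/eqP/cmP => i; rewrite cprodE count_mon_seq. Qed.

Lemma mon_mon_seq m : mon (mon_seq m) = ofmon m.
Proof. by rewrite monE cprod_mon_seq. Qed.

Lemma perm_mon_seq s : perm_eq (mon_seq (cprod s)) s.
Proof. by apply/allP => i _ /=; rewrite count_mon_seq cprodE. Qed.

Lemma cprod_eq s u : (cprod s == cprod u) = perm_eq s u.
Proof.
apply/eqP/idP => [E|/permP su].
  by apply/allP => i _ /=; rewrite -!cprodE E.
by apply/eqP/cmP => i; rewrite !cprodE su.
Qed.

Lemma sym_ind (P : S -> Prop) :
  (forall s, P (mon s)) -> P 0 ->
  (forall c x y, P x -> P y -> P (c *: x + y)) -> forall x, P x.
Proof.
move=> PM P0 PD; apply: basis_ind => // m; rewrite -mon_mon_seq; exact: PM.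
Qed.

Lemma lext0 (V : lmodType k) (f : {cmonom I} -> V) : lext f 0 = 0.
Proof. exact: lin0 (extendP f). Qed.

Section AlgExt.
Variables (B : comAlgType k) (g : I -> B).

Definition algext : S -> B := lext (fun m => \prod_(i <- mon_seq m) g i).

Lemma algextP c x y : algext (c *: x + y) = c *: algext x + algext y.
Proof. exact: extendP. Qed.

Lemma algext0 : algext 0 = 0.
Proof. exact: lext0. Qed.

Lemma algext_mon s : algext (mon s) = \prod_(i <- s) g i.
Proof. by rewrite monE /algext extendU; apply/perm_big/perm_mon_seq. Qed.

Lemma algext1 : algext 1 = 1.
Proof. by rewrite -mon_nil algext_mon big_nil. Qed.

Lemma algext_gen i : algext (generator i) = g i.
Proof. by rewrite -mon1 algext_mon big_seq1. Qed.

Lemma algextM x y : algext (x * y) = algext x * algext y.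
Proof.
elim/sym_ind: x y => [s|y|c x x' IHx IHx' y].
- elim/sym_ind => [u||c y y' IHy IHy']; rewrite ?(mulr0, algext0) //.
    by rewrite -mon_cat !algext_mon big_cat.
  by rewrite mulrDr -scalerAr !algextP IHy IHy' mulrDr scalerAr.
- by rewrite mul0r algext0 mul0r.
by rewrite mulrDl -scalerAl !algextP IHx IHx' mulrDl scalerAl.
Qed.

End AlgExt.

Section Derivation.
Variable f : I -> S.

Definition derivation_seq s : S := \sum_(p <- picks s) f p.1 * mon p.2.

Lemma derivation_seq_nil : derivation_seq [::] = 0. Proof. exact: big_nil. Qed.

Lemma derivation_seq_cons i s : derivation_seq (i :: s)
  = f i * mon s + generator i * derivation_seq s.
Proof.
rewrite /derivation_seq big_cons big_map mulr_sumr; congr (_ + _).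
by apply: eq_bigr => p _; rewrite mon_cons mulrCA.
Qed.

Lemma derivation_seq_cat s u : derivation_seq (s ++ u)
  = derivation_seq s * mon u + mon s * derivation_seq u.
Proof.
elim: s => [|i s IH] /=; first by rewrite derivation_seq_nil mon_nil mul0r add0r
  mul1r.
by rewrite !derivation_seq_cons IH mon_cons mon_cat; ring.
Qed.

Lemma perm_derivation_seq s u : perm_eq s u -> derivation_seq s = derivation_seq u.
Proof.
apply: (perm_big_picks (F := fun i v => f i * mon v)) => i v v' vv'.
by rewrite (perm_mon vv').
Qed.

Definition derivation : S -> S := lext (fun m => derivation_seq (mon_seq m)).

Lemma derivationP c x y : derivation (c *: x + y)
  = c *: derivation x + derivation y.
Proof. exact: extendP. Qed.

Lemma derivation0 : derivation 0 = 0.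
Proof. exact: lext0. Qed.

Lemma derivation_mon s : derivation (mon s) = derivation_seq s.
Proof. by rewrite monE /derivation extendU;
  apply/perm_derivation_seq/perm_mon_seq. Qed.

Lemma derivation_gen i : derivation (generator i) = f i.
Proof. by rewrite -mon1 derivation_mon derivation_seq_cons mon_nil
  derivation_seq_nil mulr1 mulr0 addr0. Qed.

Lemma derivationM x y : derivation (x * y) = derivation x * y + x * derivation y.
Proof.
elim/sym_ind: x y => [s|y|c x x' IHx IHx' y].
- elim/sym_ind => [u||c y y' IHy IHy']; rewrite ?(mulr0, derivation0, addr0) //.
    by rewrite -mon_cat !derivation_mon derivation_seq_cat.
  by rewrite mulrDr -scalerAr !derivationP IHy IHy' !mulrDr -!scalerAr scalerDr
    addrACA.
- by rewrite mul0r derivation0 !mul0r addr0.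
by rewrite mulrDl -scalerAl !derivationP IHx IHx' !mulrDl -!scalerAl scalerDr
  addrACA.
Qed.

Lemma derivation1 : derivation 1 = 0.
Proof. by rewrite -mon_nil derivation_mon derivation_seq_nil. Qed.

End Derivation.

End SymTheory.

(** * The tensor square and the unshuffle coproduct *)

Section BilinearExtension.
Variables (k : fieldType) (M N : conomType) (V : lmodType k).
Variables (S : monoid_algebra k M) (T : monoid_algebra k N) (f : M -> N -> V).

Definition biextend (x : S) (y : T) : V := extend S (fun m => extend T (f m) y) x.

Lemma biextendPl y : linear (biextend^~ y).
Proof. by move=> c x x'; rewrite /biextend extendP. Qed.

Lemma biextendPr x : linear (biextend x).
Proof.
rewrite /biextend; move=> c y y'; elim/(@basis_ind _ _ S): x => [m||d x x' IH IH'].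
- by rewrite !extendU extendP.
- by rewrite !(lin0 (extendP _)) scaler0 addr0.
by rewrite !extendP IH IH' !scalerDr !scalerA mulrC addrACA.
Qed.

Lemma biextendU m n : biextend (basis S m) (basis T n) = f m n.
Proof. by rewrite /biextend !extendU. Qed.

End BilinearExtension.

Section Tensors.
Variables (k : fieldType) (I : choiceType).
Variables (S : monoid_algebra k {cmonom I}).
Variables (S2 : monoid_algebra k ({cmonom I} * {cmonom I})%type).
Local Notation gen := (generator S).
Local Notation mon := (mon S).
Implicit Types (a b x y : S) (z : S2) (s u : seq I).

Definition tensor x y : S2 := biextend (fun m n => basis S2 (m, n)) x y.

Lemma tensPl y : linear (tensor^~ y). Proof. exact: biextendPl. Qed.
Lemma tensPr x : linear (tensor x). Proof. exact: biextendPr. Qed.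
Lemma tensDl x x' y : tensor (x + x') y = tensor x y + tensor x' y.
Proof. exact: (linD (tensPl y)). Qed.
Lemma tensDr x y y' : tensor x (y + y') = tensor x y + tensor x y'.
Proof. exact: (linD (tensPr x)). Qed.
Lemma tens0l y : tensor 0 y = 0. Proof. exact: (lin0 (tensPl y)). Qed.
Lemma tens0r x : tensor x 0 = 0. Proof. exact: (lin0 (tensPr x)). Qed.
Lemma tensU m n : tensor (basis S m) (basis S n) = basis S2 (m, n).
Proof. exact: biextendU. Qed.

Lemma bilin_ext (V : lmodType k) (f g : S -> S -> V) :
  (forall y, linear (f^~ y)) -> (forall x, linear (f x)) ->
  (forall y, linear (g^~ y)) -> (forall x, linear (g x)) ->
  (forall m n, f (basis S m) (basis S n) = g (basis S m) (basis S n)) ->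
  forall x y, f x y = g x y.
Proof.
move=> fl fr gl gr fg x y.
elim/(@basis_ind _ _ S): x y => [m|y|c x x' IHx IHx' y].
- elim/(@basis_ind _ _ S) => [n||c y y' IHy IHy']; first exact: fg.
    by rewrite (lin0 (fr _)) (lin0 (gr _)).
  by rewrite fr gr IHy IHy'.
- by rewrite (lin0 (fl _)) (lin0 (gl _)).
by rewrite fl gl IHx IHx'.
Qed.

Lemma tensM x y x' y' : tensor x y * tensor x' y' = tensor (x * x') (y * y').
Proof.
apply: (bilin_ext (f := fun x y => tensor x y * tensor x' y')
                  (g := fun x y => tensor (x * x') (y * y'))) =>
                    [{}y|{}x|{}y|{}x|m n] /=.
- by move=> c a b; rewrite tensPl mulrDl scalerAl.
- by move=> c a b; rewrite tensPr mulrDl scalerAl.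
- by move=> c a b; rewrite mulrDl -scalerAl tensPl.
- by move=> c a b; rewrite mulrDl -scalerAl tensPr.
apply: (bilin_ext (f := fun x' y' => tensor (basis S m) (basis S n) * tensor x' y')
  (g := fun x' y' => tensor (basis S m * x') (basis S n * y'))) =>
    [{}y|{}x|{}y|{}x|m' n'] /=.
- by move=> c a b; rewrite tensPl mulrDr scalerAr.
- by move=> c a b; rewrite tensPr mulrDr scalerAr.
- by move=> c a b; rewrite mulrDr -scalerAr tensPl.
- by move=> c a b; rewrite mulrDr -scalerAr tensPr.
by rewrite !basisM !tensU basisM.
Qed.

Lemma tens11 : tensor 1 1 = 1.
Proof. by rewrite -!(basis1 S) tensU -(basis1 S2). Qed.

Lemma sym2_ind (P : S2 -> Prop) :
  (forall m n, P (tensor (basis S m) (basis S n))) -> P 0 ->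
  (forall c z z', P z -> P z' -> P (c *: z + z')) -> forall z, P z.
Proof. by move=> PM P0 PD; apply: basis_ind => // -[m n]; rewrite -tensU. Qed.

(** The Guin-Oudom axioms write sums over [Sh] on pairs of basis elements; this evaluates them on
    arbitrary tensors. *)
Lemma extend_tens (V : lmodType k) (h : S -> S -> V) a b :
  (forall y, linear (h^~ y)) -> (forall x, linear (h x)) ->
  extend S2 (fun p => h (basis S p.1) (basis S p.2)) (tensor a b) = h a b.
Proof.
move=> hl hr; apply: (bilin_ext (f := fun a b => extend S2 _ (tensor a b))) => //.
- by move=> y c x x'; rewrite tensPl extendP.
- by move=> x c y y'; rewrite tensPr extendP.
by move=> m n; rewrite tensU extendU.
Qed.

Section OneSided.
Variable D : S -> S.
Hypothesis D_lin : linear D.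
Hypothesis DM : forall x y, D (x * y) = D x * y + x * D y.

Definition on_left (D : S -> S) : S2 -> S2 :=
  extend S2 (fun p => tensor (D (basis S p.1)) (basis S p.2)).
Definition on_right (D : S -> S) : S2 -> S2 :=
  extend S2 (fun p => tensor (basis S p.1) (D (basis S p.2))).

Lemma on_left_tens x y : on_left D (tensor x y) = tensor (D x) y.
Proof.
apply: (extend_tens (h := fun x y => tensor (D x) y)) => [{}y|{}x] c a b /=.
  by rewrite D_lin tensPl.
exact: tensPr.
Qed.

Lemma on_right_tens x y : on_right D (tensor x y) = tensor x (D y).
Proof.
apply: (extend_tens (h := fun x y => tensor x (D y))) => [{}y|{}x] c a b /=.
  exact: tensPl.
by rewrite D_lin tensPr.
Qed.

Lemma on_left_lin : linear (on_left D). Proof. exact: extendP. Qed.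
Lemma on_right_lin : linear (on_right D). Proof. exact: extendP. Qed.

Lemma leibniz_tens (E : S2 -> S2) : linear E ->
  (forall a b a' b', E (tensor a b * tensor a' b')
     = E (tensor a b) * tensor a' b' + tensor a b * E (tensor a' b')) ->
  forall z z', E (z * z') = E z * z' + z * E z'.
Proof.
move=> E_lin Et; have E0 := lin0 E_lin.
elim/sym2_ind => [m n|z'|c z1 z2 IH1 IH2 z'].
- elim/sym2_ind => [m' n'||c z1 z2 IH1 IH2]; rewrite ?(mulr0, E0, addr0) //.
  by rewrite mulrDr -scalerAr !E_lin IH1 IH2 !mulrDr -!scalerAr scalerDr addrACA.
- by rewrite mul0r E0 !mul0r addr0.
by rewrite mulrDl -scalerAl !E_lin IH1 IH2 !mulrDl -!scalerAl scalerDr addrACA.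
Qed.

Lemma on_leftM z z' : on_left D (z * z') = on_left D z * z' + z * on_left D z'.
Proof.
apply: (leibniz_tens on_left_lin) => a b a' b'.
by rewrite tensM !on_left_tens !tensM DM tensDl.
Qed.

Lemma on_rightM z z' : on_right D (z * z') = on_right D z * z' + z * on_right D z'.
Proof.
apply: (leibniz_tens on_right_lin) => a b a' b'.
by rewrite tensM !on_right_tens !tensM DM tensDr.
Qed.

End OneSided.

(** Subsets of positions with their complements, in a form suited to recursion on the list; repeated
    entries count separately. *)
Fixpoint splits (s : seq I) : seq (seq I * seq I) :=
  if s is i :: s' then
    [seq (i :: p.1, p.2) | p <- splits s'] ++ [seq (p.1, i :: p.2) | p <- splits s']
  else [:: ([::], [::])].

Definition unshuffle (x : S) : S2 :=
  extend S (fun m =>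
    let t := tnth (in_tuple (mon_seq m)) in
    \sum_(J : {set 'I_(size (mon_seq m))})
       tensor (\prod_(j in J) gen (t j)) (\prod_(j in ~: J) gen (t j))) x.

(** Expanding the product of the sums [tensor (gen i) 1 + tensor 1 (gen i)] gives one term for each
    subset of the factors. Multiplicativity of [unshuffle] follows. *)
Lemma unshuffle_algext x : unshuffle x
  = algext (B := S2) (fun i => tensor (gen i) 1 + tensor 1 (gen i)) x.
Proof.
elim/(@basis_ind _ _ S): x => [m||c x y IHx IHy]; last 2 first.
- by rewrite algext0 /unshuffle (lin0 (extendP _)).
- by rewrite algextP /unshuffle extendP -!/(unshuffle _) IHx IHy.
rewrite /unshuffle /algext !extendU [RHS]big_tnth bigA_distr; apply: eq_bigr => J _.
rewrite [RHS](bigID (mem J)) /=.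
have tl (J' : {set 'I_(size (mon_seq m))}) (F : 'I_(size (mon_seq m)) -> S) :
    tensor (\prod_(j in J') F j) 1 = \prod_(j in J') tensor (F j) 1.
  apply: (big_morph (fun a => tensor a 1)); last exact: tens11.
  by move=> a b; rewrite tensM mulr1.
have tr (J' : {set 'I_(size (mon_seq m))}) (F : 'I_(size (mon_seq m)) -> S) :
    tensor 1 (\prod_(j in J') F j) = \prod_(j in J') tensor 1 (F j).
  apply: (big_morph (fun a => tensor 1 a)); last exact: tens11.
  by move=> a b; rewrite tensM mulr1.
rewrite -[X in tensor X _]mulr1 -[X in tensor _ X]mul1r -tensM tl tr; congr (_ * _).
  by apply: eq_bigr => j ->.
by apply: eq_big => [j|j]; [rewrite in_setC | rewrite in_setC => /negbTE ->].
Qed.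

Lemma unshuffleM x y : unshuffle (x * y) = unshuffle x * unshuffle y.
Proof. by rewrite !unshuffle_algext algextM. Qed.

Lemma unshuffle_lin : linear unshuffle.
Proof. exact: extendP. Qed.

Lemma unshuffle_gen i : unshuffle (gen i) = tensor (gen i) 1 + tensor 1 (gen i).
Proof. by rewrite unshuffle_algext algext_gen. Qed.

Lemma unshuffle_mon s : unshuffle (mon s)
  = \sum_(p <- splits s) tensor (mon p.1) (mon p.2).
Proof.
elim: s => [|i s IH]; first by rewrite unshuffle_algext mon_nil algext1 big_seq1
  !mon_nil tens11.
rewrite mon_cons unshuffleM unshuffle_gen IH /= big_cat !big_map mulrDl
  !mulr_sumr /=.
by congr (_ + _); apply: eq_bigr => p _; rewrite tensM mul1r mon_cons.
Qed.

End Tensors.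

(** * The Guin-Oudom product *)

Section Splits.
Variables (I : choiceType) (V : nmodType).
Implicit Types (s : seq I).

Lemma size_splits s p : p \in splits s -> (size p.1 + size p.2)%N = size s.
Proof.
elim: s p => [|i s IH] p /=; first by rewrite inE => /eqP ->.
by rewrite mem_cat => /orP[] /mapP[q /IH <- ->] //=; rewrite addnS.
Qed.

Lemma big_splits_right s (F : seq I -> seq I -> V) :
  (forall a b, (size a + size b)%N = size s -> b <> [::] -> F a b = 0) ->
  \sum_(p <- splits s) F p.1 p.2 = F s [::].
Proof.
elim: s F => [|i s IH] F F0 /=; first by rewrite big_seq1.
rewrite big_cat !big_map /= [X in _ + X]big_seq [X in _ + X]big1 => [|p ps].
  by rewrite addr0 (IH (fun a => F (i :: a))) // => a b ab; apply: F0;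
    rewrite /= addSn ab.
by apply: F0; rewrite //= addnS (size_splits ps).
Qed.

Lemma big_splits_left s (F : seq I -> seq I -> V) :
  (forall a b, (size a + size b)%N = size s -> a <> [::] -> F a b = 0) ->
  \sum_(p <- splits s) F p.1 p.2 = F [::] s.
Proof.
elim: s F => [|i s IH] F F0 /=; first by rewrite big_seq1.
rewrite big_cat !big_map /= [X in X + _]big_seq [X in X + _]big1 => [|p ps].
  by rewrite add0r (IH (fun a b => F a (i :: b))) // => a b ab; apply: F0;
    rewrite /= addnS ab.
by apply: F0; rewrite //= addSn (size_splits ps).
Qed.

Lemma big_splits_ends s (F : seq I -> seq I -> V) : s <> [::] ->
  (forall a b, (size a + size b)%N = size s -> a <> [::] -> b <> [::] -> F a b
    = 0) ->
  \sum_(p <- splits s) F p.1 p.2 = F s [::] + F [::] s.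
Proof.
case: s => [|i s] // _ F0; rewrite /= big_cat !big_map /=; congr (_ + _).
  apply: (big_splits_right (F := fun a => F (i :: a))) => a b ab b0.
  by apply: F0; rewrite // /= addSn ab.
apply: (big_splits_left (F := fun a b => F a (i :: b))) => a b ab a0.
by apply: F0; rewrite // /= addnS ab.
Qed.

End Splits.

Section GuinOudom.
Variables (k : fieldType) (I : choiceType).
Variables (S : monoid_algebra k {cmonom I}).
Variables (S2 : monoid_algebra k ({cmonom I} * {cmonom I})%type).
Local Notation gen := (generator S).
Local Notation mon := (mon S).
Implicit Types (a b c x y : S) (s u : seq I).

Variables (tri : S -> S -> S) (gr : I -> I -> seq I).
Hypothesis tri_l : forall y, linear (tri^~ y).
Hypothesis tri_r : forall x, linear (tri x).
Hypothesis tri1 : forall a, tri a 1 = a.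
Hypothesis tri_mulr : forall i j a,
  tri (gen i) (a * gen j) = tri (tri (gen i) a) (gen j)
    - tri (gen i) (tri a (gen j)).
Hypothesis tri_mull : forall a b c,
  tri (a * b) c
  = extend S2 (fun p => tri a (basis S p.1) * tri b (basis S p.2)) (unshuffle S2 c).
Hypothesis tri_gen : forall i j, tri (gen i) (gen j) = \sum_(x <- gr i j) gen x.

Lemma tri_mull_mon a b s :
  tri (a * b) (mon s) = \sum_(p <- splits s) tri a (mon p.1) * tri b (mon p.2).
Proof.
rewrite tri_mull unshuffle_mon (lin_sum (extendP _)); apply: eq_bigr => p _.
apply: (@extend_tens _ _ _ S2 _ (fun x y => tri a x * tri b y)) => [y|x] d x' y' /=.
  by rewrite tri_r mulrDl scalerAl.
by rewrite tri_r mulrDr scalerAr.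
Qed.

Lemma tri_leibniz j x y : tri (x * y) (gen j)
  = tri x (gen j) * y + x * tri y (gen j).
Proof.
by rewrite -mon1 tri_mull_mon /= big_cons big_seq1 /= !mon1 mon_nil !tri1.
Qed.

(* By [tri_mull], 1 <| m is 2 (1 <| m) plus products of terms 1 <| m' with m'
   smaller than m. *)
Lemma tri_1_mon s : s <> [::] -> tri 1 (mon s) = 0.
Proof.
have [n] := ubnP (size s); elim: n s => // n IH s sn s0.
have := tri_mull_mon 1 1 s; rewrite mulr1.
rewrite (big_splits_ends (F := fun u v => tri 1 (mon u) * tri 1 (mon v))) //.
  rewrite mon_nil tri1 mulr1 mul1r => /eqP.
  by rewrite -subr_eq0 opprD addrA subrr sub0r oppr_eq0 => /eqP.
move=> u v uv u0 v0; rewrite (IH u) ?mul0r //.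
have v_gt0 : (0 < size v)%N by case: (v) v0.
by move: sn; rewrite -uv ltnS => /(leq_trans _); apply; rewrite -addn1 leq_add2l.
Qed.

Lemma tri_1_gen j : tri 1 (gen j) = 0.
Proof. by rewrite -mon1 tri_1_mon. Qed.

(** Acting by [gen j] is a derivation that replaces one factor by a sum of generators, so the number
    of factors is kept. [P] stands for any additive property known on monomials of that length. *)
Lemma tri_span (P : S -> Prop) n j : P 0 -> (forall x y, P x -> P y -> P (x + y)) ->
  (forall u, size u = n -> P (mon u)) ->
  forall s, size s = n -> P (tri (mon s) (gen j)).
Proof.
(* The empty list becomes an accumulator for the factors that the Leibniz rule has already
   passed. *)
move=> P0 PD Pn s sn; rewrite -[tri _ _]mul1r -(mon_nil S).
have : (size ([::] : seq I) + size s)%N = n by [].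
elim: s [::] {sn} => [|i s IH] p pn.
  by rewrite mon_nil tri_1_gen mulr0.
rewrite mon_cons tri_leibniz mulrDr; apply: (PD); last first.
  rewrite mulrA [X in X * _]mulrC -mon_cons; apply: IH.
  by rewrite /= addSn -addnS.
rewrite tri_gen mulr_suml mulr_sumr; apply: (big_ind P P0 PD) => i' _.
by rewrite -mon_cons -mon_cat; apply: Pn; rewrite size_cat.
Qed.

(** Acting by a primitive element is a coderivation. Since [unshuffle] is an algebra morphism and
    the action a derivation, this reduces to generators, where the result is a sum of primitive
    elements. *)
Lemma unshuffle_tri_mon s j : unshuffle S2 (tri (mon s) (gen j))
  = \sum_(p <- splits s) (tensor S2 (tri (mon p.1) (gen j)) (mon p.2)
                          + tensor S2 (mon p.1) (tri (mon p.2) (gen j))).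
Proof.
have E : unshuffle S2 (tri (mon s) (gen j))
   = on_left (tri^~ (gen j)) (unshuffle S2 (mon s))
     + on_right (tri^~ (gen j)) (unshuffle S2 (mon s)).
  have R_lin := tri_l (gen j).
  elim: s => [|i s IH].
    rewrite mon_nil tri_1_gen (lin0 (unshuffle_lin S2)) unshuffle_algext algext1
      -(tens11 S S2).
    by rewrite on_left_tens // on_right_tens // tri_1_gen tens0l tens0r addr0.
  rewrite mon_cons tri_leibniz (linD (unshuffle_lin S2)) !unshuffleM IH.
  rewrite on_leftM ?on_rightM //; try by move=> x y; apply: tri_leibniz.
  rewrite unshuffle_gen (linD (on_left_lin _)) (linD (on_right_lin _)).
  rewrite !on_left_tens // !on_right_tens // tri_1_gen tens0l tens0r addr0 add0r.
  have -> : unshuffle S2 (tri (gen i) (gen j))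
      = tensor S2 (tri (gen i) (gen j)) 1 + tensor S2 1 (tri (gen i) (gen j)).
    rewrite tri_gen (lin_sum (unshuffle_lin S2)) (lin_sum (tensPl S2 1)).
    rewrite (lin_sum (tensPr S2 1)) -big_split /=.
    by apply: eq_bigr => i' _; rewrite unshuffle_gen.
  by ring.
rewrite E unshuffle_mon (lin_sum (on_left_lin _)) (lin_sum (on_right_lin _))
  -big_split /=.
by apply: eq_bigr => p _; rewrite on_left_tens // on_right_tens.
Qed.

Lemma extend_unshuffle_tri (V : lmodType k) (h : S -> S -> V) s j :
  (forall y, linear (h^~ y)) -> (forall x, linear (h x)) ->
  extend S2 (fun p => h (basis S p.1) (basis S p.2))
    (unshuffle S2 (tri (mon s) (gen j)))
  = \sum_(p <- splits s) (h (tri (mon p.1) (gen j)) (mon p.2)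
                          + h (mon p.1) (tri (mon p.2) (gen j))).
Proof.
move=> hl hr; rewrite unshuffle_tri_mon (lin_sum (extendP _));
  apply: eq_bigr => p _.
by rewrite (linD (extendP _)) !extend_tens.
Qed.

(* [tri_mulr], extended from L to the whole of Sym(L). *)
Lemma tri_comp a s j :
  tri a (gen j * mon s) = tri (tri a (mon s)) (gen j) - tri a (tri (mon s) (gen j)).
Proof.
elim/sym_ind: a s => [u||c x y IHx IHy] s; last 2 first.
- by rewrite !(lin0 (tri_l _)) subr0.
- by rewrite !tri_l IHx IHy scalerBr opprD addrACA.
elim: u s => [|i u IH] s.
  rewrite mon_nil -mon_cons tri_1_mon //.
  (* The inner product is a sum of monomials of the same nonzero length, all killed by [tri 1]. *)
  have tri_span0 t : t <> [::] -> tri 1 (tri (mon t) (gen j)) = 0.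
    move=> t0; apply: (tri_span (P := fun x => tri 1 x = 0) (n := size t)) => //.
    - exact: lin0 (tri_r 1).
    - by move=> x y x0 y0; rewrite (linD (tri_r 1)) x0 y0 addr0.
    by move=> v vt; apply: tri_1_mon => v0; case: t t0 vt => //; rewrite v0.
  case: s => [|i s].
    by rewrite mon_nil tri1 tri_1_gen (lin0 (tri_r 1)) subr0.
  by rewrite tri_1_mon // tri_span0 // (lin0 (tri_l _)) subr0.
(* All three terms become sums over the splits of [s], the last one by the coderivation rule. The
   identity then holds split by split, from [tri_mulr] for [gen i] and the induction hypothesis for
   [mon u]. *)
rewrite -mon_cons [mon (i :: u)]mon_cons !tri_mull_mon tri_mull.
rewrite (extend_unshuffle_tri (h := fun x y => tri (gen i) x * tri (mon u) y));
  last 2 first.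
- by move=> y c x x' /=; rewrite tri_r mulrDl scalerAl.
- by move=> x c y y' /=; rewrite tri_r mulrDr scalerAr.
rewrite /= big_cat !big_map /= (lin_sum (tri_l _)).
rewrite -big_split -sumrB /=; apply: eq_bigr => p _.
by rewrite !mon_cons tri_leibniz IH [gen j * mon p.1]mulrC tri_mulr; ring.
Qed.

Definition star_product a b : S :=
  extend S2 (fun p => tri a (basis S p.1) * basis S p.2) (unshuffle S2 b).

Lemma star_l b : linear (star_product^~ b).
Proof.
move=> c x y; rewrite /star_product;
  elim/(sym2_ind (S := S)): (unshuffle S2 b) => [m n||d z z' IH IH'].
- by rewrite tensU !extendU /= tri_l mulrDl scalerAl.
- by rewrite !(lin0 (extendP _)) scaler0 addr0.
by rewrite !extendP IH IH' !scalerDr !scalerA mulrC addrACA.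
Qed.

Lemma star_r a : linear (star_product a).
Proof. by move=> c x y; rewrite /star_product unshuffle_lin extendP. Qed.

Lemma star_bilin a :
  (forall y, linear (fun x => tri a x * y)) /\
    (forall x, linear (fun y => tri a x * y)).
Proof.
split=> [y|x] c x1 x2 /=; first by rewrite tri_r mulrDl scalerAl.
by rewrite mulrDr scalerAr.
Qed.

Lemma star_mon a s :
  star_product a (mon s) = \sum_(p <- splits s) tri a (mon p.1) * mon p.2.
Proof.
have [hl hr] := star_bilin a.
rewrite /star_product unshuffle_mon (lin_sum (extendP _)); apply: eq_bigr => p _.
exact: (@extend_tens _ _ _ S2 _ (fun x y => tri a x * y)).
Qed.

Lemma star1 a : star_product a 1 = a.
Proof. by rewrite -(mon_nil S) star_mon big_seq1 mon_nil tri1 mulr1. Qed.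

Lemma star_gen a j : star_product a (gen j) = tri a (gen j) + a * gen j.
Proof. by rewrite -mon1 star_mon /= big_cons big_seq1 /= mon1 mon_nil tri1
  mulr1. Qed.

Lemma star_1_gen j : star_product 1 (gen j) = gen j.
Proof. by rewrite star_gen tri_1_gen add0r mul1r. Qed.

Lemma star_mull_gen i a j :
  star_product (gen i * a) (gen j)
    = tri (gen i) (gen j) * a + gen i * star_product a (gen j).
Proof. by rewrite !star_gen tri_leibniz; ring. Qed.

(** This is associativity with a generator as last factor, the inner product [mon s * gen j] being
    expanded by [star_gen]. It reduces to [tri_comp] and the Leibniz rule on each split of [s]. *)
Lemma star_comp a s j :
  star_product a (gen j * mon s)
    = star_product (star_product a (mon s)) (gen j)
      - star_product a (tri (mon s) (gen j)).
Proof.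
have [hl hr] := star_bilin a.
rewrite -mon_cons star_gen star_mon [star_product a (tri _ _)]/star_product.
rewrite (extend_unshuffle_tri (h := fun x y => tri a x * y)) // star_mon.
rewrite /= big_cat !big_map /= (lin_sum (tri_l _)) mulr_suml -!big_split -sumrB /=.
apply: eq_bigr => p _; rewrite !mon_cons tri_comp tri_leibniz; ring.
Qed.

End GuinOudom.

(** * Duality *)

Section Counts.
Variable A : choiceType.
Implicit Types (s u : seq (tree A)) (T U R : tree A).

Definition aut_count T U : nat := tcount (repr T) (repr U).

Definition forest_count s u : nat := fcount (map repr s) (map repr u).

Lemma aut_count_class t x : aut_count (ptree_class t) (ptree_class x) = tcount t x.
Proof. by apply: tcount_eq; apply: iso_repr. Qed.

Lemma aut_count_neq T U : T <> U -> aut_count T U = 0%N.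
Proof.
move=> TU; apply/eqP; rewrite -leqn0 leqNgt -ptree_iso_tcount; apply/negP.
by move=> /ptree_class_eq; rewrite !ptree_class_repr.
Qed.

Lemma forest_count_nil u : forest_count [::] u = (u == [::]).
Proof. by case: u => [|U u];
  rewrite /forest_count /= ?fcount_nil ?fcount_nil_cons. Qed.

Lemma forest_count_cons T s u :
  forest_count (T :: s) u
  = (\sum_(p <- picks u) aut_count T p.1 * forest_count s p.2)%N.
Proof. by rewrite /forest_count /= fcount_cons picks_map big_map. Qed.

Lemma forest_count_perm s u u' : perm_eq u u' -> forest_count s u
  = forest_count s u'.
Proof.
elim: s u u' => [|T s IH] u u' uu'.
  by rewrite !forest_count_nil -!size_eq0 (perm_size uu').
rewrite !forest_count_cons.
apply: (perm_big_picks (F := fun U v => (aut_count T U * forest_count s v)%N))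
  uu' => U v v' vv'.
by rewrite (IH _ _ vv').
Qed.

Lemma forest_count_neq s u : ~~ perm_eq s u -> forest_count s u = 0%N.
Proof.
elim: s u => [|T s IH] u su.
  by rewrite forest_count_nil; case: u su.
rewrite forest_count_cons big_seq big1 // => p /perm_picks pu.
have [Tp|/eqP Tp] := eqVneq T p.1; last by rewrite aut_count_neq.
rewrite IH ?muln0 //; apply: contra su => sp.
by rewrite -(permPr pu) Tp perm_cons.
Qed.

Lemma forest_count_gt0 s : (0 < forest_count s s)%N.
Proof.
apply/card_gt0P; exists (finfun id); apply: is_iso_ffun; split=> // [|v].
  by exists id.
by rewrite omap_id.
Qed.

Lemma num_aut_gt0 (F : forest A) : (0 < num_aut F)%N.
Proof. exact: (forest_count_gt0 (mon_seq F)). Qed.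

Lemma forest_countE s u :
  forest_count s u = if perm_eq s u then num_aut (cprod s) else 0%N.
Proof.
case: ifPn => [su|/forest_count_neq //].
have ms := perm_mon_seq s; rewrite -(forest_count_perm s su).
rewrite (forest_count_perm s (u' := mon_seq (cprod s))) 1?perm_sym //.
(* A positive count provides an isomorphism from [s] to the list used by [num_aut], along which the
   source is transported. *)
have : (0 < forest_count s (mon_seq (cprod s)))%N.
  by rewrite (forest_count_perm s ms) forest_count_gt0.
move=> /card_gt0P[f /isosP fi]; have [g [gi _ _]] := is_iso_inv fi.
apply: card_isos_eq gi _.
instantiate (1 := id); split=> // [|v]; first by exists id.
by rewrite omap_id.
Qed.

(** The root is among the vertices, and grafting there gives M(T, R); the sum of the list is thus
    all of T <| R. *)
Definition graft_seq T R : seq (tree A) :=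
  [seq ptree_class (graft (repr R) v) | v <- index_enum (vertex (repr T))].

Lemma aut_count_graft T R U :
  (\sum_(x <- graft_seq T R) aut_count x U
   = \sum_(e <- edge_cuts (repr U))
        aut_count R (ptree_class e.1) * aut_count T (ptree_class e.2))%N.
Proof.
rewrite big_map; transitivity
  (\sum_(v : vertex (repr T)) tcount (graft (repr R) v) (repr U))%N.
  by apply: eq_bigr => v _; rewrite -aut_count_class ptree_class_repr.
rewrite tcount_graft; apply: eq_bigr => e _.
by rewrite -!aut_count_class !ptree_class_repr.
Qed.

End Counts.

(** * Adjoint operators, the counit and the coproduct *)

Section Duality.
Variables (k : fieldType) (A : choiceType).
Variables (S : monoid_algebra k {cmonom tree A}).
Variables (S2 : monoid_algebra k ({cmonom tree A} * {cmonom tree A})%type).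
Local Notation gen := (generator S).
Local Notation mon := (mon S).
Local Notation tens := (tensor S2).
Implicit Types (a b x y : S) (z : S2) (s u : seq (tree A)) (T U R : tree A).

(** [f] will be the identity for operators on k[T], and [coproduct] for maps into the tensor
    square. *)
Lemma deriv_ext (V : comAlgType k) (f : S -> V) (E E' : S -> V) :
  linear E -> linear E' ->
  (forall x y, E (x * y) = E x * f y + f x * E y) ->
  (forall x y, E' (x * y) = E' x * f y + f x * E' y) ->
  f 1 = 1 -> (forall T, E (gen T) = E' (gen T)) -> E =1 E'.
Proof.
move=> El El' EM EM' f1 EE' y.
have D1 (D : S -> V) : (forall x y, D (x * y) = D x * f y + f x * D y) -> D 1 = 0.
  move=> DM; apply: (addIr (D 1)).
  by rewrite add0r -[in RHS](mulr1 1) DM f1 mulr1 mul1r.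
elim/sym_ind: y => [s||c y y' IH IH']; last 2 first.
- by rewrite !lin0.
- by rewrite El El' IH IH'.
elim: s => [|T s IH]; first by rewrite mon_nil !D1.
by rewrite mon_cons EM EM' IH EE'.
Qed.

Definition form (x y : S) : k :=
  biextend (V := k^o) (fun F G => if F == G then (num_aut F)%:R else 0) x y.

Lemma form_l y : linear ((form^~ y) : S -> k^o). Proof. exact: biextendPl. Qed.
Lemma form_r x : linear (form x : S -> k^o). Proof. exact: biextendPr. Qed.

Lemma form_mon s u : form (mon s) (mon u) = (forest_count s u)%:R.
Proof.
rewrite !monE /form biextendU cprod_eq forest_countE.
by case: ifP.
Qed.

(** This is s_T d/dT, since [aut_count T U] vanishes unless [U] is [T]. *)
Definition partial T : S -> S := derivation (fun U => ((aut_count T U)%:R)%:A).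

(** On monomials both sides are sums over the tree of [y] that receives [T]. *)
Lemma form_mul_gen T x y : form (gen T * x) y = form x (partial T y).
Proof.
elim/sym_ind: x => [s||c x x' IH IH']; last 2 first.
- by rewrite mulr0 !(lin0 (form_l _)).
- by rewrite mulrDr -scalerAr !form_l IH IH'.
elim/sym_ind: y => [u||c y y' IH IH']; last 2 first.
- by rewrite /partial derivation0 !(lin0 (form_r _)).
- by rewrite /partial derivationP !form_r -!/(partial _ _) IH IH'.
rewrite -mon_cons form_mon forest_count_cons /partial derivation_mon
  /derivation_seq natr_sum.
rewrite (lin_sum (form_r _)); apply: eq_bigr => p _.
by rewrite -scalerAl mul1r (linZ (form_r _)) form_mon natrM.
Qed.

Lemma form_1_gen T x : form 1 (gen T * x) = 0.
Proof.
elim/sym_ind: x => [u||c y y' IH IH']; last 2 first.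
- by rewrite mulr0 (lin0 (form_r _)).
- by rewrite mulrDr -scalerAr form_r IH IH' scaler0 addr0.
by rewrite -(mon_nil S) -mon_cons form_mon forest_count_nil.
Qed.

Lemma form_11 : form 1 1 = 1.
Proof. by rewrite -(mon_nil S) form_mon forest_count_nil. Qed.

(** [form 1] is the counit: it reads the coefficient of the empty forest, which has one
    automorphism. *)
Lemma form_1M x y : form 1 (x * y) = form 1 x * form 1 y.
Proof.
elim/sym_ind: x => [s||c x x' IH IH']; last 2 first.
- by rewrite mul0r !(lin0 (form_r _)) mul0r.
- by rewrite mulrDl -scalerAl !form_r IH IH' mulrDl -mulrA.
case: s => [|T s]; first by rewrite mon_nil mul1r form_11 mul1r.
by rewrite mon_cons -mulrA !form_1_gen mul0r.
Qed.

Definition tree_coproduct T : S2 :=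
  tens (gen T) 1 + \sum_(C : {set vertex (repr T)} | admissible C)
    tens (\prod_(e in C) gen (ptree_class (subtree e)))
      (gen (ptree_class (remainder (mem C)))).

Definition coproduct : S -> S2 := algext tree_coproduct.

Lemma tree_coproductE T :
  tree_coproduct T = tens (gen T) 1
    + cut_sum gen (fun a X => tens a (gen X)) (repr T).
Proof.
congr (_ + _).
exact: (@sum_admissible A S S2 (fun t => gen (ptree_class t)) (repr T)
  (fun a t => tens a (gen (ptree_class t)))).
Qed.

Lemma coproduct_gen T : coproduct (gen T) = tree_coproduct T.
Proof. exact: algext_gen. Qed.

Section Operators.
Variable R : tree A.

(* Adjoint to right multiplication by [R]; see [form_star_gen]. *)
Definition graft_adjoint : S -> S := derivation (fun U => ((aut_count R U)%:R)%:A
  + edge_cut_sum (fun Q X => (aut_count R Q)%:R *: gen X) (repr U)).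

Lemma graft_adjoint_class t : graft_adjoint (gen (ptree_class t))
  = ((aut_count R (ptree_class t))%:R)%:A
  + edge_cut_sum (fun Q X => (aut_count R Q)%:R *: gen X) t.
Proof.
rewrite /graft_adjoint derivation_gen; congr (_ + _); apply: edge_cut_sum_iso;
  exact: iso_repr.
Qed.

(** Dual to 1 * R = R: an edge cut always leaves a tree, which the counit kills, so only the
    constants of the derivation survive. *)
Lemma form_1_graft_adjoint y : form 1 (graft_adjoint y) = form 1 (partial R y).
Proof.
elim/sym_ind: y => [s||c y y' IH IH']; last 2 first.
- by rewrite /graft_adjoint /partial !derivation0.
- by rewrite /graft_adjoint /partial !derivationP !form_r -!/(graft_adjoint _)
  -!/(partial R _) IH IH'.
case: s => [|T s]; first by rewrite mon_nil /graft_adjoint /partial !derivation1.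
rewrite mon_cons /graft_adjoint /partial !derivationM !(linD (form_r _))
  !form_1_gen !addr0.
rewrite !form_1M !derivation_gen; congr (_ * _).
rewrite (linD (form_r _)) (lin_sum (form_r _)) big1 ?addr0 // => e _.
by rewrite (linZ (form_r _)) -[gen _]mulr1 form_1_gen scaler0.
Qed.

(** Dual to (T x) * R = (T <| R) x + T (x * R). The commutator of two derivations is a derivation,
    so trees suffice, and there the claim is [aut_count_graft]. *)
Lemma partial_graft_adjoint T y :
  partial T (graft_adjoint y)
    = graft_adjoint (partial T y) + \sum_(x <- graft_seq T R) partial x y.
Proof.
pose E y := partial T (graft_adjoint y) - graft_adjoint (partial T y).
pose E' y := \sum_(x <- graft_seq T R) partial x y.
suff EE' : E =1 E' by rewrite -[X in _ = _ + X](EE' y) /E addrC subrK.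
apply: (@deriv_ext S id) => //.
- move=> c a b; rewrite /E /graft_adjoint /partial !derivationP scalerBr; ring.
- by move=> c a b; rewrite /E' scaler_sumr -big_split /=; apply: eq_bigr => U _;
  rewrite /partial derivationP.
- by move=> a b; rewrite /E /graft_adjoint /partial !derivationM
  !(linD (derivationP _)) !derivationM; ring.
- move=> a b; rewrite /E' mulr_suml mulr_sumr -big_split /=.
  by apply: eq_bigr => U _; rewrite /partial derivationM.
move=> U; rewrite /E /E' /graft_adjoint /partial !derivation_gen
  (linZ (derivationP _)) derivation1 scaler0 subr0.
rewrite (linD (derivationP _)) (linZ (derivationP _)) derivation1 scaler0 add0r
  (lin_sum (derivationP _)).
under [RHS]eq_bigr do rewrite derivation_gen.
rewrite -scaler_suml -natr_sum aut_count_graft natr_sum scaler_suml.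
by apply: eq_bigr => e _;
  rewrite (linZ (derivationP _)) derivation_gen scalerA natrM.
Qed.

Lemma coproduct_graft_adjoint y : coproduct (graft_adjoint y)
  = on_left graft_adjoint (coproduct y).
Proof.
have D_lin : linear graft_adjoint by exact: derivationP.
have DM : forall x y, graft_adjoint (x * y)
  = graft_adjoint x * y + x * graft_adjoint y by exact: derivationM.
have Dl : linear coproduct by exact: algextP.
apply: (@deriv_ext S2 coproduct (coproduct \o graft_adjoint)
  (on_left graft_adjoint \o coproduct)).
- by move=> c a b /=; rewrite D_lin Dl.
- by move=> c a b /=; rewrite Dl on_left_lin.
- by move=> a b /=; rewrite DM (linD Dl) /coproduct !algextM.
- by move=> a b /=; rewrite /coproduct algextM on_leftM.
- exact: algext1.
move=> U /=; rewrite coproduct_gen tree_coproductE (linD (on_left_lin _))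
  on_left_tens //.
rewrite [X in _ = _ + X](lin_sum (on_left_lin _)).
under [X in _ = _ + X]eq_bigr do rewrite on_left_tens //.
rewrite [X in _ = _ + X](cut_sum_derivation (D := graft_adjoint)
  (c := fun Q => (aut_count R Q)%:R)
  DM graft_adjoint_class (h := fun a X => tens a (gen X))); last by move=> X;
    apply: tensPl.
(* The constant of [graft_adjoint (gen U)] gives a multiple of 1 on both sides. For an edge cut
   leaving [X], the term [tens (gen X) 1] comes from [tens (gen U) 1], and the cuts of [X] come from
   [cut_sum_derivation]. *)
rewrite {1 2}/graft_adjoint derivation_gen (linD Dl) (linD (tensPl _ _)) -addrA;
  congr (_ + _).
  by rewrite (linZ Dl) (linZ (tensPl _ _)) /coproduct algext1 tens11.
rewrite (lin_sum Dl) (lin_sum (tensPl _ _)) -big_split /=; apply: eq_bigr => e _.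
rewrite (linZ Dl) (linZ (tensPl _ _)) -scalerDr coproduct_gen tree_coproductE.
congr (_ *: (_ + _)); exact: cut_sum_iso (iso_repr _).
Qed.

End Operators.

(** The counit kills P^C for every nonempty cut, and the empty cut leaves [t] itself. *)
Lemma form_cut_sum (V : lmodType k) (F : tree A -> V) t :
  cut_sum gen (fun a X => form 1 a *: F X) t = F (ptree_class t).
Proof.
elim: t F => [a|l IHl r IHr] F.
  by rewrite /cut_sum big_seq1 big_nil form_11 scale1r.
rewrite cut_sum_node ptree_class_node.
rewrite [X in _ + (X + _)]big1 => [|c _]; last by rewrite form_1_gen scale0r.
rewrite [X in _ + (_ + X)]big1 => [|c _]; last by rewrite form_1_gen scale0r.
rewrite !addr0 -(IHl (fun X => F (tnode X (ptree_class r)))).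
apply: eq_cut_sum => a X;
  rewrite -(IHr (fun Y => F (tnode X Y))) /cut_sum scaler_sumr.
by apply: eq_bigr => c _; rewrite form_1M scalerA.
Qed.

Definition counit_left : S2 -> S :=
  extend S2 (fun p => form 1 (basis S p.1) *: basis S p.2).

Lemma counit_left_tens x y : counit_left (tens x y) = form 1 x *: y.
Proof.
apply: (@extend_tens _ _ _ S2 _ (fun x y => form 1 x *: y)) => [{}y|{}x] c a b /=.
  by rewrite form_r scalerDl scalerA.
by rewrite scalerDr !scalerA mulrC.
Qed.

Lemma counit_leftM z z' : counit_left (z * z') = counit_left z * counit_left z'.
Proof.
have El : linear counit_left by exact: extendP.
elim/(sym2_ind (S := S)): z z' => [m n|z'|c z1 z2 IH1 IH2 z'].
- elim/(sym2_ind (S := S)) => [m' n'||c z1 z2 IH1 IH2]; last 2 first.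
  + by rewrite mulr0 (lin0 El) mulr0.
  + by rewrite mulrDr -scalerAr !El IH1 IH2 mulrDr -scalerAr.
  by rewrite tensM !counit_left_tens form_1M -scalerAl -scalerAr scalerA.
- by rewrite mul0r (lin0 El) mul0r.
by rewrite mulrDl -scalerAl !El IH1 IH2 mulrDl -scalerAl.
Qed.

(** With [form2_1_tens], this is the case F2 = 1 of the duality, where its induction starts. *)
Lemma counit_left_coproduct y : counit_left (coproduct y) = y.
Proof.
have El : linear counit_left by exact: extendP.
have Dl : linear coproduct by exact: algextP.
elim/sym_ind: y => [s||c y y' IH IH']; last 2 first.
- by rewrite (lin0 Dl) (lin0 El).
- by rewrite Dl El IH IH'.
elim: s => [|T s IH].
  by rewrite mon_nil /coproduct algext1 -(tens11 S S2) counit_left_tens form_11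
    scale1r.
rewrite mon_cons {1}/coproduct algextM -/coproduct counit_leftM IH; congr (_ * _).
rewrite coproduct_gen tree_coproductE (linD El) counit_left_tens.
rewrite -[X in form 1 X]mulr1 form_1_gen scale0r add0r /cut_sum (lin_sum El).
under eq_bigr do rewrite counit_left_tens.
by rewrite -[in RHS](ptree_class_repr T) -(form_cut_sum (fun X => gen X)).
Qed.

Definition form2 (z z' : S2) : k :=
  biextend (V := k^o) (fun p q =>
    form (basis S p.1) (basis S q.1) * form (basis S p.2) (basis S q.2)) z z'.

Lemma form2_l z : linear ((form2^~ z) : S2 -> k^o). Proof. exact: biextendPl. Qed.
Lemma form2_r z : linear (form2 z : S2 -> k^o). Proof. exact: biextendPr. Qed.

Lemma form2_basis p q : form2 (basis S2 p) (basis S2 q)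
  = (num_aut p.1)%:R * (num_aut p.2)%:R * (q == p)%:R.
Proof.
rewrite /form2 biextendU /form !biextendU.
case: p q => [p1 p2] [q1 q2] /=; rewrite xpair_eqE [q1 == _]eq_sym [q2 == _]eq_sym.
by case: eqP => _; case: eqP => _; rewrite ?mul0r ?mulr0 ?mulr1.
Qed.

Lemma form2_tens x y x' y' :
  form2 (tens x y) (tens x' y') = form x x' * form y y'.
Proof.
have H := @bilin_ext k _ S k^o.
apply: (H (fun x y => form2 (tens x y) (tens x' y'))
  (fun x y => form x x' * form y y'))
  => [{}y|{}x|{}y|{}x|m n] /=.
- by move=> c a b; rewrite tensPl form2_l.
- by move=> c a b; rewrite tensPr form2_l.
- by move=> c a b; rewrite form_l mulrDl -mulrA.
- by move=> c a b; rewrite form_l mulrDr mulrCA.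
apply: (H (fun x' y' => form2 (tens (basis S m) (basis S n)) (tens x' y'))
  (fun x' y' => form (basis S m) x' * form (basis S n) y')) =>
    [{}y'|{}x'|{}y'|{}x'|m' n'] /=.
- by move=> c a b; rewrite tensPl form2_r.
- by move=> c a b; rewrite tensPr form2_r.
- by move=> c a b; rewrite form_r mulrDl -mulrA.
- by move=> c a b; rewrite form_r mulrDr mulrCA.
by rewrite !tensU /form2 biextendU.
Qed.

Lemma form2_1_tens a z : form2 (tens 1 a) z = form a (counit_left z).
Proof.
elim/(sym2_ind (S := S)): z => [m n||c z z' IH IH'].
- by rewrite form2_tens counit_left_tens (linZ (form_r _)).
- by rewrite (lin0 (form2_r _)) /counit_left (lin0 (extendP _)) (lin0 (form_r _)).
by rewrite form2_r /counit_left extendP form_r -!/(counit_left _) IH IH'.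
Qed.

Section Star.
Variable tri : S -> S -> S.
Hypothesis tri_l : forall y, linear (tri^~ y).
Hypothesis tri_r : forall x, linear (tri x).
Hypothesis tri1 : forall a, tri a 1 = a.
Hypothesis tri_mulr : forall T U a,
  tri (gen T) (a * gen U) = tri (tri (gen T) a) (gen U)
    - tri (gen T) (tri a (gen U)).
Hypothesis tri_mull : forall a b c,
  tri (a * b) c
  = extend S2 (fun p => tri a (basis S p.1) * tri b (basis S p.2)) (unshuffle S2 c).
Hypothesis tri_gen : forall T U, tri (gen T) (gen U)
  = \sum_(x <- graft_seq T U) gen x.

Local Notation star := (star_product S2 tri).

(** In the induction on the trees of [x], the two terms of [star_mull_gen] are adjoint to the two
    terms of [partial_graft_adjoint]. *)
Lemma form_star_gen R x y : form (star x (gen R)) y = form x (graft_adjoint R y).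
Proof.
have sl := star_l S2 tri_l.
elim/sym_ind: x y => [s|y|c x x' IH IH' y]; last 2 first.
- by rewrite (lin0 (sl _)) !(lin0 (form_l _)).
- by rewrite sl !form_l IH IH'.
elim: s => [|T s IH] y.
  by rewrite mon_nil (star_1_gen tri_r) // form_1_graft_adjoint -form_mul_gen mulr1.
rewrite mon_cons (star_mull_gen tri_r) // (linD (form_l _)) !form_mul_gen
  IH partial_graft_adjoint.
rewrite (linD (form_r _)) addrC; congr (_ + _).
rewrite tri_gen mulr_suml (lin_sum (form_l _)) (lin_sum (form_r _)).
by apply: eq_bigr => U _; rewrite form_mul_gen.
Qed.

Lemma form2_star_gen R a b z :
  form2 (tens (star b (gen R)) a) z
    = form2 (tens b a) (on_left (graft_adjoint R) z).
Proof.
have D_lin : linear (graft_adjoint R) by exact: derivationP.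
elim/(sym2_ind (S := S)): z => [m n||c z z' IH IH'].
- by rewrite on_left_tens // !form2_tens form_star_gen.
- by rewrite (lin0 (on_left_lin _)) !(lin0 (form2_r _)).
by rewrite on_left_lin !form2_r IH IH'.
Qed.

Lemma form_star a b y : form (star a b) y = form2 (tens b a) (coproduct y).
Proof.
have sr := star_r S2 tri; have sl := star_l S2 tri_l.
elim/sym_ind: b a y => [s|a y|c b b' IH IH' a y]; last 2 first.
- by rewrite (lin0 (sr _)) tens0l (lin0 (form_l _)) (lin0 (form2_l _)).
- by rewrite sr form_l tensPl form2_l IH IH'.
have [n] := ubnP (size s); elim: n s => // n IHn [|R s] sn a y.
  by rewrite mon_nil (star1 S2 tri_r tri1) form2_1_tens counit_left_coproduct.
have IH u : (size u <= size s)%N ->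
    forall a y, form (star a (mon u)) y = form2 (tens (mon u) a) (coproduct y).
  by move=> us; apply: IHn; apply: leq_ltn_trans us _.
rewrite mon_cons (star_comp tri_l tri_r tri1 tri_mulr tri_mull tri_gen)
  (linB (form_l _)) form_star_gen IH //.
(* Moving the operator back turns [mon s] into [star (mon s) (gen R)], that is [tri (mon s) (gen R)]
   plus the wanted product. The [tri] part cancels the correction from [star_comp]. *)
rewrite coproduct_graft_adjoint -form2_star_gen (star_gen S2 tri_r tri1) tensDl
  (linD (form2_l _)).
have -> : form (star a (tri (mon s) (gen R))) y
  = form2 (tens (tri (mon s) (gen R)) a) (coproduct y).
  apply: (tri_span tri_r tri1 tri_mull tri_gen
    (P := fun b => form (star a b) y = form2 (tens b a) (coproduct y))
      (n := size s)) => //.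
  - by rewrite (lin0 (sr _)) tens0l (lin0 (form_l _)) (lin0 (form2_l _)).
  - by move=> b b' Hb Hb'; rewrite (linD (sr _)) (linD (form_l _)) tensDl
    (linD (form2_l _)) Hb Hb'.
  by move=> u us; apply: IH; rewrite us.
by rewrite [gen R * _]mulrC addrC addKr.
Qed.

End Star.
End Duality.

(** * Transfer to the monoid algebra and reading off coefficients *)

Section Concrete.
Variables (k : fieldType) (A : choiceType).
Local Notation Sym := (malg_algebra k {cmonom tree A}).
Local Notation Sym2 := (malg_algebra k ({cmonom tree A} * {cmonom tree A})%type).

Lemma inclU (T : tree A) : incl << T >> = gen k T.
Proof. exact: linextU. Qed.

Lemma incl_prelie (T U : tree A) :
  incl (prelie << T >> << U >> : {malg k[tree A]})
    = \sum_(x <- graft_seq T U) gen k x.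
Proof.
rewrite /prelie /bilext !linextU /tree_prelie.
have il := linext_is_linear (gen k (I := tree A)).
rewrite [LHS](linD il) (lin_sum il) big_map [RHS](bigD1 (troot (repr T))) //=.
rewrite graft_root; congr (_ + _); first exact: inclU.
by apply: eq_big => [v|v _]; [rewrite !inE | apply: inclU].
Qed.

Lemma pairing_star (tri :
  {bilinear sym k (tree A) -> sym k (tree A) -> sym k (tree A)})
  (x y z : sym k (tree A)) :
  guin_oudom (@prelie k A) tri ->
  pairing (star tri x y) z = pairing2 (tens y x) (Delta z).
Proof.
move=> [go1 go2 go3 go4].
(* For [malg_algebra], the abstract product, coproduct and pairings are convertible to those of the
   statement. *)
apply: (@form_star k A Sym Sym2 tri).
- by move=> y' c a b; apply: linearPl.
- by move=> x' c a b; apply: linearPr.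
- exact: go2.
- move=> T U a.
  (* Abstracting the two inclusions lets [inclU] act by substitution. *)
  have subst x' y' : incl << T >> = x' -> incl << U >> = y' ->
      tri x' (a * y') = tri (tri x' a) y' - tri x' (tri a y').
    by move=> <- <-; apply: go3.
  apply: (etrans (subst _ _ (inclU T) (inclU U))).
  by apply: congr2; [reflexivity | apply: congr1; reflexivity].
- exact: go4.
move=> T U; apply: etrans (incl_prelie T U).
have subst x' y' : incl << T >> = x' -> incl << U >> = y' ->
    tri x' y' = incl (prelie << T >> << U >>) by move=> <- <-; apply: go1.
exact: subst (inclU T) (inclU U).
Qed.

(** Pairing with a basis tensor reads off a coefficient up to a product of two automorphism numbers;
    nondegeneracy comes down to these being nonzero in [k]. *)
Lemma pairing2U (p : forest A * forest A) (z : sym2 k (tree A)) :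
  pairing2 << p >> z = (num_aut p.1)%:R * (num_aut p.2)%:R * z@_p.
Proof.
have pl := @form2_r k A Sym Sym2 << p >>.
elim/malg_lin_ind: z => [q||c z z' IH IH'].
- by rewrite mcoeffU1; apply: (@form2_basis k A Sym Sym2 p q).
- by rewrite mcoeff0 mulr0; apply: (lin0 pl).
rewrite mcoeffD mcoeffZ mulrDr mulrCA -IH -IH'; exact: pl.
Qed.

End Concrete.

Theorem theorem4p1 (k : fieldType) (A : choiceType)
    (tri : {bilinear sym k (tree A) -> sym k (tree A) -> sym k (tree A)}) :
  [pchar k] =i pred0 ->
  guin_oudom (@prelie k A) tri ->
  (forall F1 F2 F3 : forest A,
     pairing (star tri << F1 >> << F2 >>) << F3 >>
     = pairing2 (tens << F2 >> << F1 >>) (Delta << F3 >>))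
  /\
  (forall Delta_star : {linear sym k (tree A) -> sym2 k (tree A)},
     (forall F1 F2 F3 : forest A,
        pairing (star tri << F1 >> << F2 >>) << F3 >>
        = pairing2 (tens << F2 >> << F1 >>) (Delta_star << F3 >>)) ->
     forall x : sym k (tree A), Delta x = Delta_star x).
Proof.
move=> char0 go; have main F1 F2 F3 := pairing_star << F1 >> << F2 >> << F3 >> go.
split=> // Ds DsE x.
have aut_neq0 (F : forest A) : (num_aut F)%:R != 0 :> k.
  by have /pcharf0P -> := char0; rewrite -lt0n num_aut_gt0.
elim/malg_lin_ind: x => [F3||c x y IHx IHy].
- apply/malgP => -[F2 F1]; have := main F1 F2 F3; rewrite DsE.
  have -> : tens << F2 >> << F1 >> = << (F2, F1) >> :> sym2 k (tree A).
    by rewrite /tens /bilext !linextU.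
  rewrite !pairing2U => /esym /mulfI; apply.
  by rewrite mulf_neq0.
- by rewrite linear0; apply: (lin0 (linext_is_linear _)).
by rewrite linearP -IHx -IHy; apply: linext_is_linear.
Qed.
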